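(* Let $1\le p\le2$ and $\frac1p+\frac1{p'}=1$. There is a constant $C_p\ge1$ such that for all $f\in L^p(\Omega)$ and $a\in l^p(\mathrm L)$ we have $$\|\widehat f\|_{l^{p'}(\mathrm L)}\le C_p\|f\|_{L^p(\Omega)}\quad\text{and}\quad\|\mathcal F_{\mathrm L}^{-1}a\|_{L^{p'}(\Omega)}\le C_p\|a\|_{l^p(\mathrm L)}.$$ Similarly, we also have $$\|\widehat f_*\|_{l^{p'}(\mathrm L^* )}\le C_p\|f\|_{L^p(\Omega)}\quad\text{and}\quad\|\mathcal F_{\mathrm L^*}^{-1}b\|_{L^{p'}(\Omega)}\le C_p\|b\|_{l^p(\mathrm L^* )}$$ for all $f\in L^p(\Omega)$ and $b\in l^p(\mathrm L^* )$.
   Context: Setting. $\Omega\subset\mathbb R^n$ ($n\ge 1$) is a bounded open set. $\mathrm L$ is a differential operator of order $m$ with smooth coefficients in $\Omega$, equipped with linear boundary conditions (the functions satisfying them form a linear space), viewed as an operator in $L^2(\Omega)$ with domain $\mathrm{Dom}(\mathrm L)$; $\mathrm L^*$ is its adjoint, with the adjoint boundary conditions and domain $\mathrm{Dom}(\mathrm L^* )$. $\mathcal I$ is a countable subset of some $\mathbb Z^K$; $\mathrm L$ has discrete spectrum $\{\lambda_\xi\}_{\xi\in\mathcal I}\subset\mathbb C$, listed with multiplicities so that $|\lambda_j|\le|\lambda_k|$ whenever $|j|\le|k|$. There are eigenfunctions $u_\xi\in\mathrm{Dom}(\mathrm L)$, $\mathrm Lu_\xi=\lambda_\xi u_\xi$,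 and $v_\xi\in\mathrm{Dom}(\mathrm L^* )$, $\mathrm L^*v_\xi=\overline{\lambda_\xi}v_\xi$, with $\|u_\xi\|_{L^2}=1$ and $(u_\xi,v_\eta)_{L^2}=\delta_{\xi\eta}$, where $(f,g)_{L^2}=\int_\Omega f\overline g\,dx$; both $\{u_\xi\}$ and $\{v_\xi\}$ are Riesz bases of $L^2(\Omega)$. Put $\langle\xi\rangle=(1+|\lambda_\xi|^2)^{1/(2m)}$. Boundary conditions are preserved under limits (the spaces $\bigcap_k\mathrm{Dom}(\mathrm L^k)$ and $\bigcap_k\mathrm{Dom}((\mathrm L^* )^k)$ with norms $\max_{j\le k}\|\mathrm L^j\varphi\|_{L^2}$, resp. $\max_{j\le k}\|(\mathrm L^* )^j\varphi\|_{L^2}$, are complete). Fourier transforms: $\widehat f(\xi)=\int_\Omega f\,\overline{v_\xi}\,dx$, $\widehat f_*(\xi)=\int_\Omega f\,\overline{u_\xi}\,dx$; inverse transforms $\mathcal F_{\mathrm L}^{-1}a=\sum_{\xi\in\mathcal I}a(\xi)u_\xi$, $\mathcal F_{\mathrm L^*}^{-1}b=\sum_{\xi\in\mathcal I}b(\xi)v_\xi$. $\mathcal S'(\mathcal I)$ is the set of $a:\mathcal I\to\mathbb C$ with $|a(\xi)|\le C\langle\xi\rangle^M$ for some $C,M$. $l^p(\mathrm L)$ is the space of $a\in\mathcal S'(\mathcal I)$ with finite norm $\|a\|_{l^p(\mathrm L)}=(\sum_\xi|a(\xi)|^p\|u_\xi\|_{L^\infty(\Omega)}^{2-p})^{1/p}$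 for $1\le p\le2$; $\|a\|_{l^p(\mathrm L)}=(\sum_\xi|a(\xi)|^p\|v_\xi\|_{L^\infty(\Omega)}^{2-p})^{1/p}$ for $2\le p<\infty$; $\|a\|_{l^\infty(\mathrm L)}=\sup_\xi|a(\xi)|\,\|v_\xi\|_{L^\infty(\Omega)}^{-1}$. $l^p(\mathrm L^* )$ is defined in the same way with the roles of $u_\xi$ and $v_\xi$ interchanged. These definitions presuppose $u_\xi,v_\xi\in L^\infty(\Omega)$. *)

(* Defs.v *)
From HB Require Import structures.
From mathcomp Require Import all_boot all_order all_algebra finmap complex.
From mathcomp Require Import all_classical all_reals all_analysis.

Set Implicit Arguments.
Unset Strict Implicit.
Unset Printing Implicit Defensive.

Import Order.TTheory GRing.Theory Num.Theory.
Import numFieldNormedType.Exports.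
Import ComplexField.Normc.

Local Open Scope classical_set_scope.
Local Open Scope ring_scope.
Local Open Scope complex_scope.

Section rV_measurable.
Context {R : realType} (n : nat).

Definition rV_coord (i : 'I_n) (x : 'rV[R]_n) : measurableTypeR R := x ord0 i.

Let rV_set0 : g_sigma_preimage rV_coord set0.
Proof. exact: sigma_algebra0. Qed.

Let rV_setC A : g_sigma_preimage rV_coord A -> g_sigma_preimage rV_coord (~` A).
Proof. exact: sigma_algebraC. Qed.

Let rV_bigcup (F : (set 'rV[R]_n)^nat) :
  (forall i, g_sigma_preimage rV_coord (F i)) ->
  g_sigma_preimage rV_coord (\bigcup_i (F i)).
Proof. exact: sigma_algebra_bigcup. Qed.

Definition rV_display : measure_display.
Proof. exact: default_measure_display. Qed.

(* The Borel sigma-algebra, as the product sigma-algebra. *)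
HB.instance Definition _ := @isMeasurable.Build rV_display
  'rV[R]_n (g_sigma_preimage rV_coord) rV_set0 rV_setC rV_bigcup.

End rV_measurable.

Section rV_measurable_lemmas.
Context {R : realType}.

Lemma measurable_rV_coord n (i : 'I_n) :
  measurable_fun [set: 'rV[R]_n] (@rV_coord R n i).
Proof.
move=> _ Y mY; rewrite setTI.
suff : g_sigma_preimage (@rV_coord R n) (rV_coord i @^-1` Y) by [].
apply: sub_sigma_algebra.
case: n i => [[]//|n] i; rewrite -bigcup_mkord_ord.
exists (i : nat) => //=; exists Y => //.
by rewrite setTI inord_val.
Qed.

Lemma measurable_rVP d (T : measurableType d) n (f : T -> 'rV[R]_n) :
  (forall i, measurable_fun [set: T] (@rV_coord R n i \o f)) ->
  measurable_fun [set: T] f.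
Proof.
move=> mf; apply: (@measurability _ _ _ _ _ _
  (\big[setU/set0]_(i < n) preimage_set_system setT (@rV_coord R n i) measurable)).
  by [].
move=> _ [B + <-].
case: n f mf B => [|n] f mf B; first by rewrite big_ord0.
rewrite -bigcup_mkord_ord => -[i _ [Y mY <-]].
have := mf (inord i) measurableT Y mY.
by rewrite !setTI comp_preimage.
Qed.

End rV_measurable_lemmas.

Section lebesgue_rV.
Context {R : realType}.

Section successor.
Context (n : nat).
Variable m : {sigma_finite_measure set 'rV[R]_n -> \bar R}.

Definition rV_cons (z : measurableTypeR R * 'rV[R]_n) : 'rV[R]_n.+1 :=
  row_mx (z.1%:M : 'rV[R]_1) z.2.

Definition rV_uncons (x : 'rV[R]_n.+1) : measurableTypeR R * 'rV[R]_n :=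
  (rV_coord ord0 x, rsubmx (x : 'rV[R]_(1 + n))).

Lemma rV_consE0 z (i : 'I_1) : rV_cons z ord0 (lshift n i) = z.1.
Proof. by rewrite /rV_cons [LHS](@row_mxEl _ 1 1 n) !mxE !ord1 eqxx mulr1n. Qed.

Lemma rV_consES z i : rV_cons z ord0 (rshift 1 i) = z.2 ord0 i.
Proof. by rewrite /rV_cons [LHS](@row_mxEr _ 1 1 n). Qed.

Lemma rV_consK : cancel rV_cons rV_uncons.
Proof.
move=> [a v]; rewrite /rV_uncons; congr (_, _); last by rewrite row_mxKr.
rewrite /rV_coord (_ : ord0 = lshift n (ord0 : 'I_1)); last exact: val_inj.
exact: rV_consE0.
Qed.

Lemma measurable_rV_cons : measurable_fun setT rV_cons.
Proof.
apply: measurable_rVP => i.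
have [j ->|j ->] := split_ordP (i : 'I_(1 + n)).
  rewrite (_ : _ \o _ = fst); first exact: measurable_fst.
  by apply/funext => z; exact: rV_consE0.
rewrite (_ : _ \o _ = @rV_coord R n j \o snd); last first.
  by apply/funext => z; exact: rV_consES.
by apply: measurableT_comp; [exact: measurable_rV_coord|exact: measurable_snd].
Qed.

Lemma measurable_rV_uncons : measurable_fun setT rV_uncons.
Proof.
apply/measurable_fun_pairP; split.
  exact: measurable_rV_coord.
apply: measurable_rVP => i.
rewrite (_ : _ \o _ = @rV_coord R n.+1 (rshift 1 i)); last first.
  by apply/funext => x; rewrite /rV_coord /= mxE.
exact: measurable_rV_coord.
Qed.

Definition lebesgueS : set 'rV[R]_n.+1 -> \bar R :=
  pushforward (@lebesgue_measure R \x m)%E rV_cons.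

Let lebesgueS0 : lebesgueS set0 = 0%E.
Proof. by rewrite /lebesgueS /pushforward preimage_set0 measure0. Qed.

Let lebesgueS_ge0 A : (0 <= lebesgueS A)%E.
Proof. by rewrite /lebesgueS /pushforward measure_ge0. Qed.

Let lebesgueS_sigma_additive : semi_sigma_additive lebesgueS.
Proof.
move=> F mF tF mUF; rewrite /lebesgueS /pushforward preimage_bigcup.
apply: measure_semi_sigma_additive.
- by move=> k; rewrite -[X in measurable X]setTI; exact: measurable_rV_cons.
- apply/trivIsetP => /= i j _ _ ij; rewrite -preimage_setI.
  by move/trivIsetP : tF => /(_ _ _ _ _ ij) ->//; rewrite preimage_set0.
- rewrite -preimage_bigcup -[X in measurable X]setTI.
  exact: measurable_rV_cons.
Qed.

HB.instance Definition _ := isMeasure.Build _ _ _ lebesgueS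
  lebesgueS0 lebesgueS_ge0 lebesgueS_sigma_additive.

Let lebesgueS_sigma_finite : sigma_finite setT lebesgueS.
Proof.
have /sigma_finiteP[F [TF ndF Foo]] := sigma_finiteT (@lebesgue_measure R).
have /sigma_finiteP[G [TG ndG Goo]] := sigma_finiteT m.
exists (fun k => rV_uncons @^-1` (F k `*` G k)).
  rewrite -preimage_bigcup (_ : \bigcup_i _ = setT) ?preimage_setT//.
  rewrite -subTset => -[x y] _.
  have [i _ Fix] : (\bigcup_i F i) x by rewrite -TF.
  have [j _ Gjy] : (\bigcup_i G i) y by rewrite -TG.
  exists (maxn i j) => //; split.
  - by move: x Fix; exact/subsetPset/ndF/leq_maxl.
  - by move: y Gjy; exact/subsetPset/ndG/leq_maxr.
move=> k; have [mF Fk] := Foo k; have [mG Gk] := Goo k; split.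
  rewrite -[X in measurable X]setTI; apply: measurable_rV_uncons => //.
  exact: measurableX.
rewrite /lebesgueS /pushforward -comp_preimage.
rewrite (_ : rV_uncons \o rV_cons = id); last exact/funext/rV_consK.
by rewrite preimage_id product_measure1E// lte_mul_pinfty// ge0_fin_numE.
Qed.

HB.instance Definition _ := @Measure_isSigmaFinite.Build _ _ _
  lebesgueS lebesgueS_sigma_finite.

End successor.

(* Lebesgue measure on R^n, as an iterated product measure transported along
   R x R^n = R^(n+1); see [lebesgue_rV_box]. *)
Fixpoint lebesgue_rV (n : nat) : {sigma_finite_measure set 'rV[R]_n -> \bar R} :=
  match n with
  | 0 => \d_(0 : 'rV[R]_0)
  | n'.+1 => lebesgueS (lebesgue_rV n')
  end.

End lebesgue_rV.

Lemma lebesgue_rV_box (R : realType) (n : nat) (a b : 'rV[R]_n) :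
  (forall i, a ord0 i <= b ord0 i) ->
  lebesgue_rV n [set x | forall i, a ord0 i < x ord0 i <= b ord0 i] =
    (\prod_i (b ord0 i - a ord0 i))%:E.
Proof.
elim: n a b => [|n IH] a b ab.
  rewrite big_ord0 /= diracE mem_set//= => -[]//.
have ord0E : ord0 = lshift n (ord0 : 'I_1) by exact: val_inj.
have box_measurable m (c d : 'rV[R]_m) :
    measurable [set x : 'rV[R]_m | forall i, c ord0 i < x ord0 i <= d ord0 i].
  rewrite (_ : [set _ | _] =
      \bigcap_(i in [set: 'I_m]) (@rV_coord R m i @^-1` `]c ord0 i, d ord0 i])).
    apply: fin_bigcap_measurable => // i _.
    by rewrite -[X in measurable X]setTI; exact: measurable_rV_coord.
  apply/seteqP; split=> x /= xcd i; first by move=> _; rewrite /= in_itv /= xcd.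
  by have := xcd i Logic.I; rewrite /= in_itv.
rewrite /= /lebesgueS /pushforward.
rewrite (_ : _ @^-1` _ = `]a ord0 ord0, b ord0 ord0] `*`
   [set y : 'rV[R]_n | forall i, (rsubmx (a : 'rV_(1 + n))) ord0 i < y ord0 i
      <= (rsubmx (b : 'rV_(1 + n))) ord0 i]).
  rewrite product_measure1E//; last exact: box_measurable.
  rewrite IH => [|i]; last by rewrite !mxE.
  rewrite [X in (X * _)%E](_ : _ = (b ord0 ord0 - a ord0 ord0)%:E); last first.
    rewrite [LHS]lebesgue_measure_itv/= lte_fin.
    have := ab ord0; rewrite le_eqVlt => /predU1P[->|->//].
    by rewrite ltxx subrr.
  rewrite -EFinM; congr EFin; rewrite [RHS]big_ord_recl.
  congr (_ * _); apply: eq_bigr => i _; rewrite !mxE.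
  by rewrite (_ : rshift 1 i = lift ord0 i); last exact: val_inj.
apply/seteqP; split=> [[r y] /= h|[r y] /= [h1 h2] i].
  split=> [|i]; rewrite /= ?in_itv /=.
    by have := h (lshift n (ord0 : 'I_1)); rewrite rV_consE0 /= -ord0E.
  by have := h (rshift 1 i); rewrite rV_consES !mxE.
have [j ->|j ->] := split_ordP (i : 'I_(1 + n)).
  rewrite rV_consE0 /= (_ : lshift n j = ord0); last by rewrite ord0E ord1.
  by move: h1; rewrite in_itv.
by rewrite rV_consES; have := h2 j; rewrite !mxE.
Qed.

Section complex_functions.
Context {R : realType} {n : nat}.
Local Notation Rn := 'rV[R]_n.
Local Notation C := R[i].
Implicit Types (Omega : set Rn) (f g h : Rn -> C) (p : \bar R).

Definition cmeasurable_fun Omega f :=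
  measurable_fun Omega (fun x => complex.Re (f x)) /\
  measurable_fun Omega (fun x => complex.Im (f x)).

Definition cintegral Omega f : C :=
  Complex (\int[lebesgue_rV n]_(x in Omega) complex.Re (f x))
          (\int[lebesgue_rV n]_(x in Omega) complex.Im (f x)).

Definition ae_equal Omega f g :=
  \forall x \ae @lebesgue_rV R n, Omega x -> f x = g x.

(* [h \_ Omega] is [h] extended by 0 outside [Omega]. *)
Definition LpN Omega p f : \bar R :=
  'N[lebesgue_rV n]_p[(fun x => (normc (f x))%:E) \_ Omega].

Definition memLp Omega p f := cmeasurable_fun Omega f /\ (LpN Omega p f < +oo)%E.

Definition inner Omega f g : C := cintegral Omega (fun x => f x * conjc (g x)).

Definition partial (i : 'I_n) f : Rn -> C := fun x =>
  Complex ('D_(delta_mx ord0 i : Rn) (fun y => complex.Re (f y)) x)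
          ('D_(delta_mx ord0 i : Rn) (fun y => complex.Im (f y)) x).

Definition smooth_on Omega f :=
  forall (s : seq 'I_n) (x : Rn), Omega x ->
    let g := foldr partial f s in
    [/\ {for x, continuous (fun y => complex.Re (g y))},
        {for x, continuous (fun y => complex.Im (g y))} &
        forall i : 'I_n,
          derivable (fun y => complex.Re (g y)) x (delta_mx ord0 i) /\
          derivable (fun y => complex.Im (g y)) x (delta_mx ord0 i)].

Definition test_function Omega f :=
  let supp := closure [set x | f x != 0] in
  [/\ smooth_on setT f, compact supp & supp `<=` Omega].

End complex_functions.

Section differential_operators.
Context {R : realType} {n : nat} (Omega : set 'rV[R]_n).
Local Notation Rn := 'rV[R]_n.
Local Notation C := R[i].

Section order.
Context (m : nat).
(* Multi-indices with all entries at most [m]; only those with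
   [mdegree alpha <= m] matter below. *)
Local Notation multi_index := {ffun 'I_n -> 'I_m.+1}.

Definition mdegree (alpha : multi_index) : nat := (\sum_i alpha i)%N.

Definition mpartial (alpha : multi_index) (f : Rn -> C) : Rn -> C :=
  foldr (fun i g => iter (alpha i) (partial i) g) f (enum 'I_n).

Implicit Type a : multi_index -> Rn -> C.

Definition has_order a :=
  exists2 alpha, mdegree alpha = m & exists2 x, Omega x & a alpha x != 0.

(* The formal transpose of [\sum_alpha a_alpha D^alpha]. *)
Definition transpose_op a (phi : Rn -> C) : Rn -> C := fun x =>
  \sum_(alpha : multi_index | (mdegree alpha <= m)%N)
    (-1) ^+ mdegree alpha * mpartial alpha (fun y => a alpha y * phi y) x.

(* [\sum_alpha a_alpha D^alpha f = h] in the sense of distributions. *)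
Definition weak_diff_eq a (f h : Rn -> C) :=
  forall phi, test_function Omega phi ->
    cintegral Omega (fun x => h x * phi x) =
    cintegral Omega (fun x => f x * transpose_op a phi x).

(* Operators in L^2(Omega) are represented by their graphs, i.e. by relations
   between square-integrable functions that respect equality almost everywhere.
   This is the realization of [\sum_alpha a_alpha D^alpha] whose domain consists
   of the f in L^2(Omega) with (a representative) satisfying the boundary
   conditions [BC] and with image in L^2(Omega). *)
Definition diff_op a (BC : set (Rn -> C)) (f h : Rn -> C) :=
  [/\ memLp Omega 2%:E f, memLp Omega 2%:E h,
      exists2 g, BC g & ae_equal Omega f g & weak_diff_eq a f h].

End order.

Definition linear_space (V : set (Rn -> C)) :=
  V (fun=> 0) /\
  forall (c : C) f g, V f -> V g -> V (fun x => c * f x + g x).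

Implicit Type T : (Rn -> C) -> (Rn -> C) -> Prop.

(* The Hilbert space adjoint; it is single-valued when T is densely defined. *)
Definition adjoint T (g h : Rn -> C) :=
  [/\ memLp Omega 2%:E g, memLp Omega 2%:E h &
      forall f k, T f k -> inner Omega k g = inner Omega f h].

Fixpoint op_pow T (k : nat) (f h : Rn -> C) : Prop :=
  match k with
  | 0 => [/\ memLp Omega 2%:E f, memLp Omega 2%:E h & ae_equal Omega f h]
  | k'.+1 => exists2 g, T f g & op_pow T k' g h
  end.

Definition dom_infty T : set (Rn -> C) :=
  [set f | forall k, exists h, op_pow T k f h].

(* The supremum below is max_(j <= k) ||T^j f||_(L^2) when T is single-valued. *)
Definition graph_norm T (k : nat) (f : Rn -> C) : \bar R :=
  ereal_sup [set y | exists j h,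
    [/\ (j <= k)%N, op_pow T j f h & y = LpN Omega 2%:E h]].

Definition dom_infty_complete T :=
  forall phi : nat -> Rn -> C,
    (forall i, dom_infty T (phi i)) ->
    (forall (k : nat) (eps : R), 0 < eps -> exists N : nat,
       forall i j, (N <= i)%N -> (N <= j)%N ->
         (graph_norm T k (fun x => phi i x - phi j x)%R < eps%:E)%E) ->
  exists2 psi, dom_infty T psi &
    forall (k : nat) (eps : R), 0 < eps -> exists N : nat,
       forall i, (N <= i)%N ->
         (graph_norm T k (fun x => phi i x - psi x)%R < eps%:E)%E.

(* [shift_op T mu] is the graph of T - mu. *)
Definition shift_op T (mu : C) (f h : Rn -> C) := T f (fun x => h x + mu * f x).

(* T - mu is onto and has a bounded inverse; the bound gives injectivity. *)
Definition resolvent_set T : set C :=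
  [set mu |
    (forall h, memLp Omega 2%:E h -> exists f, shift_op T mu f h) /\
    exists B : R, forall f h, shift_op T mu f h ->
      (LpN Omega 2%:E f <= B%:E * LpN Omega 2%:E h)%E].

Definition spectrum T : set C := ~` resolvent_set T.

Definition root_space T (mu : C) : set (Rn -> C) :=
  [set f | exists k, op_pow (shift_op T mu) k f (fun=> 0)].

(* The dimension of V modulo equality almost everywhere is d. *)
Definition has_dim (V : set (Rn -> C)) (d : nat) :=
  exists b : 'I_d -> Rn -> C,
    [/\ forall i, V (b i),
        forall c : 'I_d -> C,
          ae_equal Omega (fun x => \sum_i c i * b i x) (fun=> 0) ->
          forall i, c i = 0 &
        forall f, V f ->
          exists c : 'I_d -> C, ae_equal Omega f (fun x => \sum_i c i * b i x)].

End differential_operators.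

Section systems.
Context {R : realType} {n : nat} (Omega : set 'rV[R]_n).
Local Notation Rn := 'rV[R]_n.
Local Notation C := R[i].
(* Families indexed by a set [I] of points of Z^K are functions on the whole of
   Z^K whose values outside [I] are irrelevant. *)
Context {K : nat} (I : set 'rV[int]_K).
Local Notation ZK := 'rV[int]_K.

(* The square of the Euclidean norm |j|. *)
Definition sqnorm (j : ZK) : int := \sum_i j ord0 i ^+ 2.

(* The spectrum of T consists of isolated points, which are eigenvalues of
   finite algebraic multiplicity; [lambda] enumerates them with multiplicities,
   in the order of increasing modulus. *)
Definition discrete_spectrum T (lambda : ZK -> C) :=
  [/\ spectrum Omega T = [set lambda xi | xi in I],
      forall mu, spectrum Omega T mu -> exists2 eps : R, 0 < eps &
        forall nu, spectrum Omega T nu -> normc (nu - mu) < eps -> nu = mu,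
      forall mu, spectrum Omega T mu ->
        exists2 A : {fset ZK}, [set` A] = [set xi | I xi /\ lambda xi = mu] &
          has_dim Omega (root_space Omega T mu) #|` A| &
      forall j k, I j -> I k -> sqnorm j <= sqnorm k ->
        normc (lambda j) <= normc (lambda k)].

Definition lincomb (A : {fset ZK}) (c : ZK -> C) (u : ZK -> Rn -> C) : Rn -> C :=
  fun x => \sum_(xi <- A) c xi * u xi x.

(* Riesz basis: a complete system for which the norm of finite combinations is
   equivalent to the l^2 norm of the coefficients. *)
Definition riesz_basis (u : ZK -> Rn -> C) :=
  [/\ forall xi, I xi -> memLp Omega 2%:E (u xi),
      forall f, memLp Omega 2%:E f -> forall eps : R, 0 < eps ->
        exists (A : {fset ZK}) (c : ZK -> C), [set` A] `<=` I /\
          (LpN Omega 2%:E (fun x => f x - lincomb A c u x)%R < eps%:E)%E &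
      exists B1 B2 : R, 0 < B1 /\
        forall (A : {fset ZK}) (c : ZK -> C), [set` A] `<=` I ->
          let s := \sum_(xi <- A) normc (c xi) ^+ 2 in
          ((B1 * s)%:E <= LpN Omega 2%:E (lincomb A c u) `^ 2 <= (B2 * s)%:E)%E].

Definition bracket (m : nat) (lambda : ZK -> C) (xi : ZK) : R :=
  (1 + normc (lambda xi) ^+ 2) `^ (2 * m%:R)^-1.

Definition slow_growth (m : nat) (lambda : ZK -> C) (a : ZK -> C) :=
  exists c M : R, forall xi, I xi -> normc (a xi) <= c * bracket m lambda xi `^ M.

Definition supN (u : ZK -> Rn -> C) (xi : ZK) : R := fine (LpN Omega +oo (u xi)).

(* The norm of l^p(L) is [lpN u v p] and that of l^p(L^* ) is [lpN v u p]. *)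
Definition lpN (u v : ZK -> Rn -> C) (p : \bar R) (a : ZK -> C) : \bar R :=
  match p with
  | r%:E =>
      let w := if r <= 2 then supN u else supN v in
      ((\esum_(xi in I) (normc (a xi) `^ r * w xi `^ (2 - r))%:E) `^ r^-1)%E
  | +oo%E => ereal_sup [set (normc (a xi) * (supN v xi)^-1)%:E | xi in I]
  | -oo%E => 0%E
  end.

Definition memlp (m : nat) (lambda : ZK -> C) (u v : ZK -> Rn -> C) (p : \bar R)
    (a : ZK -> C) :=
  slow_growth m lambda a /\ (lpN u v p a < +oo)%E.

Definition fourier (v : ZK -> Rn -> C) (f : Rn -> C) (xi : ZK) : C :=
  inner Omega f (v xi).

(* [g] is the sum of the series [\sum_(xi in I) a xi * u xi], which converges
   unconditionally in L^2(Omega). *)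
Definition inverse_fourier (u : ZK -> Rn -> C) (a : ZK -> C) (g : Rn -> C) :=
  memLp Omega 2%:E g /\
  forall eps : R, 0 < eps -> exists A0 : {fset ZK}, [set` A0] `<=` I /\
    forall A : {fset ZK}, (A0 `<=` A)%fset -> [set` A] `<=` I ->
      (LpN Omega 2%:E (fun x => g x - lincomb A a u x)%R < eps%:E)%E.

End systems.

(* Main.v *)
Require Import Defs.
From HB Require Import structures.
From mathcomp Require Import all_boot all_order all_algebra finmap complex.
From mathcomp Require Import all_classical all_reals all_analysis.
From mathcomp Require Import measurable_realfun ess_sup_inf ring lra.

Set Implicit Arguments.
Unset Strict Implicit.
Unset Printing Implicit Defensive.

Import Order.TTheory GRing.Theory Num.Theory.
Import numFieldNormedType.Exports.

Local Open Scope classical_set_scope.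
Local Open Scope ring_scope.

(** Write q for the conjugate exponent p' of p and W xi for the sup norm of the
    function that is paired with f at the index xi.  Both families are treated
    alike, so one statement for a bounded Riesz basis u, namely
    [hausdorff_young], is applied to u and to v.

    Analysis.  The sequence of pairings (f, u xi) obeys two endpoint bounds.  In
    L^1 each pairing is at most W xi times the L^1 norm of f.  In L^2 the upper
    Riesz inequality gives, by testing f against the combination of the u xi
    whose coefficients are the pairings themselves, Bessel's inequality
    ([bessel_le]).  With the normalised coefficients |(f, u xi)| / W xi and the
    weights (W xi)^2 on the index set, these say that f |-> coefficients is
    bounded from L^1 to weighted l^oo and from L^2 to weighted l^2; the claim is
    boundedness from L^p to weighted l^q in between.  As no sharp constant is
    asked for, Marcinkiewicz' real-variable argument suffices: at a level t the
    function f is cut where t |f|^(p-1) = 2 N, with N at least the integral of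
    |f|^p.  The part above the cut has L^1 norm at most t / 2, so it moves no
    coefficient by more than half the level ([weak_type_le]), and the part below
    it is controlled by Bessel.  Summing over dyadic levels and exchanging the
    sum with the integral leaves a geometric sum that is comparable to
    N^(q-2) |f|^p ([marcinkiewicz]).

    Synthesis.  The lower Riesz inequality keeps the sup norms W xi away from 0,
    because the domain has finite measure.  Hence the weighted l^p space lies in
    l^2 ([sum_sqr_le]), and the series converges unconditionally in L^2 by the
    Riesz-Fischer theorem ([inverse_fourier_exists]).  Its sum g is estimated by
    duality with the analysis bound: pairing g with h = |g|^(q-2) g, truncated
    where |g| is large so that h is bounded, yields the integral of |g|^q on one
    side and, by Hoelder's inequality over the indices, the l^p norm of the
    coefficients times the bound for the pairings of h on the other
    ([inverse_fourier_moment_le]); for q = oo one takes for h the phase of g on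
    the set where |g| exceeds the claimed bound ([inverse_fourier_sup_le]). *)

(** * Dyadic levels and finite sums *)

Section dyadic.
Context {R : realType}.
Implicit Types (al t x : R) (J : nat).

Lemma powR_homo_ge0 (a x y : R) : 0 <= a -> 0 <= x -> x <= y -> x `^ a <= y `^ a.
Proof.
move=> a0 x0 xy; apply: ge0_ler_powR => //; rewrite nnegrE//.
exact: le_trans xy.
Qed.

Lemma powR2_gt1 (a : R) : 0 < a -> 1 < 2 `^ a.
Proof.
move=> a0.
have := gt0_ltr_powR a0 (_ : 1 \in Num.nneg) (_ : 2 \in Num.nneg) (ltr1n R 2).
by rewrite powR1; apply; rewrite nnegrE.
Qed.

Let pow2M al t J : 0 < t ->
  (t * 2 ^+ J) `^ al = t `^ al * (2 `^ al) ^+ J :> R.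
Proof.
move=> t0; rewrite powRM ?ltW ?exprn_gt0//; congr (_ * _).
by rewrite -[RHS]powR_mulrn ?powR_ge0// -[RHS]powRrM mulrC powRrM powR_mulrn.
Qed.

(** The dyadic sum is geometric, hence comparable to its last term; together
    with [le_dyadic_sum] it replaces the formula writing a power of [x] as an
    integral over the levels below [x]. *)
Lemma dyadic_sum_le al t x J : 0 < al -> 0 < t ->
  \sum_(j < J | t * 2 ^+ j <= x) (t * 2 ^+ j.+1) `^ al <=
    (2 `^ al) ^+ 2 / (2 `^ al - 1) * x `^ al.
Proof.
move=> al0 t0; have r1 := powR2_gt1 al0.
have rB : 0 < 2 `^ al - 1 :> R by rewrite subr_gt0.
elim: J => [|J IH].
  by rewrite big_ord0 mulr_ge0 ?powR_ge0// divr_ge0 ?sqr_ge0 ?ltW.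
rewrite big_mkcond big_ord_recr/= -big_mkcond/=.
case: ifPn => [Jx|_]; last by rewrite addr0.
have x0 : 0 <= x by apply: le_trans Jx; rewrite mulr_ge0 ?ltW ?exprn_gt0.
have -> : \sum_(i < J | t * 2 ^+ i <= x) (t * 2 ^+ i.+1) `^ al =
    \sum_(i < J) t `^ al * (2 `^ al) ^+ i.+1.
  apply: eq_big => [i|i _]; last by rewrite pow2M.
  apply/idP; apply: le_trans Jx; rewrite ler_pM2l// ler_eXn2l ?ltr1n//.
  exact/ltnW/ltn_ord.
apply: (@le_trans _ _ ((2 `^ al) ^+ 2 / (2 `^ al - 1) * (t * 2 ^+ J) `^ al)).
  rewrite !pow2M//; move: (2 `^ al) r1 rB {IH} => r r1 rB.
  have r0 : 0 < r by exact: lt_trans r1.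
  suff -> : \sum_(i < J) t `^ al * r ^+ i.+1 =
      t `^ al * r * (r ^+ J - 1) / (r - 1).
    rewrite -subr_ge0 [X in 0 <= X](_ : _ = t `^ al * r / (r - 1)).
      by rewrite divr_ge0 ?mulr_ge0 ?powR_ge0 ?ltW.
    by rewrite [r ^+ J.+1]exprS; field; rewrite gt_eqF.
  apply: (mulIf (lt0r_neq0 rB)); rewrite mulfVK ?gt_eqF//.
  rewrite -mulrA [r ^+ J - 1]subrX1 mulrA -mulr_sumr.
  under eq_bigr do rewrite exprS; rewrite -mulr_sumr; ring.
apply: ler_wpM2l; first by rewrite divr_ge0 ?sqr_ge0 ?ltW.
by apply: powR_homo_ge0 => //; rewrite ?mulr_ge0 ?exprn_ge0 ?(ltW al0)// ltW.
Qed.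

Lemma le_dyadic_sum al t x J : 0 < al -> 0 < t -> t <= x -> x < t * 2 ^+ J ->
  x `^ al <= \sum_(j < J | t * 2 ^+ j <= x) (t * 2 ^+ j.+1) `^ al.
Proof.
move=> al0 t0 tx; have x0 : 0 <= x by rewrite (le_trans _ tx) ?ltW.
elim: J => [|J IH]; first by rewrite expr0 mulr1 ltNge tx.
move=> xJ; rewrite big_mkcond big_ord_recr/= -big_mkcond/=.
case: ifPn => [Jx|]; last by rewrite -ltNge addr0.
rewrite (@le_trans _ _ ((t * 2 ^+ J.+1) `^ al))//.
  by apply: powR_homo_ge0 => //; exact: ltW.
by rewrite lerDr sumr_ge0// => i _; exact: powR_ge0.
Qed.

Lemma dyadic_range (T : eqType) (s : seq T) (x : T -> R) :
  exists2 t, 0 < t & exists J, forall i, i \in s -> 0 < x i ->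
    t <= x i < t * 2 ^+ J.
Proof.
have [t t0 ts] : exists2 t, 0 < t & forall i, i \in s -> 0 < x i -> t <= x i.
  elim: s => [|k s [t t0 IH]]; first by exists 1.
  have [xk|xk] := ltP 0 (x k); last first.
    exists t => // i; rewrite inE => /predU1P[->|/IH//].
    by rewrite ltNge xk.
  exists (Num.min t (x k)); first by rewrite lt_min t0.
  move=> i; rewrite inE => /predU1P[->|/IH h /h]; first by rewrite ge_min lexx orbT.
  by rewrite ge_min => ->.
exists t => //.
suff [J Js] : exists J, forall i, i \in s -> x i < t * 2 ^+ J.
  by exists J => i si xi; rewrite ts//= Js.
elim: s {ts} => [|k s [J IH]]; first by exists 0%N.
have [J' xJ'] : exists J', x k < t * 2 ^+ J'.
  exists (Num.bound (x k / t)); rewrite mulrC -ltr_pdivrMr//.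
  exact: upper_nthrootP.
exists (maxn J J') => i; rewrite inE => /predU1P[->|/IH h].
  apply: (lt_le_trans xJ'); rewrite ler_pM2l// ler_eXn2l ?ltr1n//.
  exact: leq_maxr.
apply: (lt_le_trans h); rewrite ler_pM2l// ler_eXn2l ?ltr1n//.
exact: leq_maxl.
Qed.
End dyadic.
Section finite_sums.
Context {R : realType}.

(** Only finitely many dyadic levels are needed, because there are finitely many
    values [x i]: one side of every later exchange of sums and integrals is a
    finite sum. *)
Lemma layer_cake_le (T : eqType) (s : seq T) (x m : T -> R) (al : R) :
  0 < al -> (forall i, 0 <= x i) -> (forall i, 0 <= m i) ->
  exists2 t, 0 < t & exists J,
    \sum_(i <- s) x i `^ (al + 2) * m i <=
    \sum_(j < J) (t * 2 ^+ j.+1) `^ al *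
      \sum_(i <- s | t * 2 ^+ j <= x i) x i ^+ 2 * m i.
Proof.
move=> al0 x0 m0; have [t t0 [J tJ]] := dyadic_range s x.
exists t => //; exists J.
under [leRHS]eq_bigr do rewrite mulr_sumr.
rewrite [leRHS](exchange_big_dep xpredT)//= big_seq [leRHS]big_seq.
apply: ler_sum => i si; rewrite -mulr_suml mulrA ler_wpM2r//.
have [xi0|xi0] := eqVneq (x i) 0.
  rewrite xi0 powR0 ?gt_eqF ?addr_gt0//.
  by rewrite expr0n mulr0.
have xi : 0 < x i by rewrite lt_neqAle eq_sym xi0 x0.
rewrite powRD ?xi0 ?implybT// powR_mulrn// ler_wpM2r ?sqr_ge0//.
by have /andP[] := tJ _ si xi; exact: le_dyadic_sum.
Qed.

(** The exponent [p] comes back because [(p - 1) * (q - 2) = 2 - p] for conjugate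
    [p] and [q]. *)
Lemma powR_level (a M p al : R) : 0 < a -> 0 <= M -> (p - 1) * al = 2 - p ->
  (M / a `^ (p - 1)) `^ al * a ^+ 2 = M `^ al * a `^ p.
Proof.
move=> a0 M0 pal.
have a1 : 0 <= (a `^ (p - 1))^-1 by rewrite invr_ge0 powR_ge0.
rewrite (powRM _ M0 a1) -mulrA; congr (_ * _).
rewrite -powRN -powRrM mulNr pal -powR_mulrn ?ltW// -powRD.
  by congr (_ `^ _); ring.
by rewrite (gt_eqF a0) implybT.
Qed.

(** The weight of l^q is that of the quotients [a / b] with respect to the
    measure with masses [b ^+ 2]. *)
Lemma powR_weight (a b q : R) : 0 <= a -> 0 < b ->
  (a / b) `^ q * b ^+ 2 = a `^ q * b `^ (2 - q).
Proof.
move=> a0 b0; have b1 : 0 <= b^-1 by rewrite invr_ge0 ltW.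
rewrite (powRM _ a0 b1) -mulrA; congr (_ * _).
rewrite powRB; last by rewrite (gt_eqF b0) implybT.
rewrite powR_mulrn ?ltW// mulrC; congr (_ * _).
by rewrite -powR_inv1 ?ltW// -powRrM mulN1r powRN.
Qed.

Lemma powR_weighted (r y x : R) : 0 < r -> 0 <= x ->
  (x * y `^ ((2 - r) / r)) `^ r = x `^ r * y `^ (2 - r).
Proof. by move=> r0 x0; rewrite powRM ?powR_ge0// -powRrM divfK ?gt_eqF. Qed.

Lemma hoelder_sum (T : Type) (s : seq T) (a b : T -> R) (p q : R) :
  (forall i, 0 <= a i) -> (forall i, 0 <= b i) ->
  0 < p -> 0 < q -> p^-1 + q^-1 = 1 ->
  \sum_(i <- s) a i * b i <=
    (\sum_(i <- s) a i `^ p) `^ p^-1 * (\sum_(i <- s) b i `^ q) `^ q^-1.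
Proof.
move=> a0 b0 p0 q0 pq; elim: s => [|k s IH].
  by rewrite !big_nil mulr_ge0 ?powR_ge0.
rewrite !big_cons.
set A := \sum_(i <- s) a i `^ p in IH *; set B := \sum_(i <- s) b i `^ q in IH *.
have A0 : 0 <= A by apply: sumr_ge0 => i _; exact: powR_ge0.
have B0 : 0 <= B by apply: sumr_ge0 => i _; exact: powR_ge0.
have AE : (A `^ p^-1) `^ p = A by rewrite -powRrM mulVf ?gt_eqF// powRr1.
have BE : (B `^ q^-1) `^ q = B by rewrite -powRrM mulVf ?gt_eqF// powRr1.
move: (A `^ p^-1) (B `^ q^-1) AE BE IH (powR_ge0 A p^-1) (powR_ge0 B q^-1).
move=> a' b' <- <- IH a'0 b'0.
by apply: le_trans (hoelder2 _ _ _ _ p0 q0 pq) => //; rewrite lerD2l.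
Qed.
End finite_sums.
(** * Open and bounded sets of row vectors *)

Section row_vectors.
Context {R : realType} {n : nat}.
Local Notation Rn := 'rV[R]_n.

Lemma measurable_rV_box (a b : Rn) :
  measurable [set x : Rn | forall i, a ord0 i < x ord0 i <= b ord0 i].
Proof.
rewrite (_ : [set _ | _] =
    \bigcap_(i in [set: 'I_n]) (@rV_coord R n i @^-1` `]a ord0 i, b ord0 i])).
  apply: fin_bigcap_measurable => // i _.
  by rewrite -[X in measurable X]setTI; exact: measurable_rV_coord.
apply/seteqP; split=> x /= xab i; first by move=> _; rewrite /= in_itv /= xab.
by have := xab i Logic.I; rewrite /= in_itv.
Qed.

(** The sigma-algebra is generated by the coordinates: an open set is the
    countable union of the cubes with rational centres and radii [1 / k.+1] that
    it contains. *)
Lemma open_rV_measurable (A : set Rn) : open A -> measurable A.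
Proof.
move=> oA.
pose box (ck : 'rV[rat]_n * nat) : set Rn := [set x | forall i : 'I_n,
  ratr (ck.1 ord0 i) - ck.2.+1%:R^-1 < x ord0 i <=
  ratr (ck.1 ord0 i) + ck.2.+1%:R^-1].
have mbox ck : measurable (box ck).
  have := measurable_rV_box (\row_i (ratr (ck.1 ord0 i) - ck.2.+1%:R^-1))
    (\row_i (ratr (ck.1 ord0 i) + ck.2.+1%:R^-1)).
  by congr measurable; apply/seteqP; split=> x /= h i; have := h i; rewrite !mxE.
rewrite (_ : A = \bigcup_ck (if `[< box ck `<=` A >] then box ck else set0)).
  apply: countable_bigcupT_measurable; first exact: countableP.
  by move=> ck; case: ifPn.
apply/seteqP; split=> [x Ax|x [ck _]]; last by case: ifPn => // /asboolP; apply.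
have [e /= e0 eA] : nbhs_ball x A by apply/nbhs_ballP; apply: open_nbhs_nbhs.
have [k ke] : exists k : nat, k.+1%:R^-1 < e / 2.
  exists (Num.truncn (e / 2)^-1); rewrite invf_plt ?posrE ?divr_gt0//.
  exact: truncnS_gt.
have /(_ _)/cid-/all_sig[c cP] (i : 'I_n) : exists q : rat,
    ratr q \in `]x ord0 i - k.+1%:R^-1, x ord0 i + k.+1%:R^-1[.
  by apply: rat_in_itvoo; rewrite ltrBlDr -addrA ltrDl addr_gt0.
have {}cP i : x ord0 i - k.+1%:R^-1 < ratr (c i) < x ord0 i + k.+1%:R^-1.
  by have := cP i; rewrite in_itv.
exists (\row_i c i, k) => //; rewrite ifT.
  move=> i; move: (cP i); rewrite /= !mxE; move: (_^-1) (ratr _) => d q.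
  by move=> /andP[? ?]; apply/andP; split; lra.
apply/asboolP => y yb; apply: eA; split=> // i j.
rewrite ord1 /ball/=; move: (yb j) (cP j) ke; rewrite /= !mxE.
move: (_^-1) (ratr _) => d q /andP[? ?] /andP[? ?] ?; rewrite ltr_norml; apply/andP; split; lra.
Qed.

Lemma bounded_lebesgue_rV (A : set Rn) : measurable A -> bounded_set A ->
  (lebesgue_rV n A < +oo)%E.
Proof.
move=> mA [M0 [_ /(_ (`|M0| + 1))]].
have M00 : M0 < `|M0| + 1 by rewrite (le_lt_trans (ler_norm _))// ltrDl.
move=> /(_ M00) /= AM; set M := `|M0| + 1 in AM.
pose b : Rn := const_mx (M + 1).
have b0 i : (- b) ord0 i <= b ord0 i.
  by rewrite !mxE; have := normr_ge0 M0; rewrite /M; lra.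
rewrite (@le_lt_trans _ _ (lebesgue_rV n
  [set x : Rn | forall i, (- b) ord0 i < x ord0 i <= b ord0 i]))//.
  apply: le_measure; rewrite ?inE//; first exact: measurable_rV_box.
  move=> x /AM /= xM i; rewrite !mxE.
  have : `|x ord0 i| <= M.
    apply: le_trans xM; rewrite /Num.Def.normr/= mx_normrE.
    by apply: (le_bigmax _ (fun ij => `|x ij.1 ij.2|) (ord0, i)).
  by rewrite ler_norml => /andP[? ?]; apply/andP; split; lra.
by rewrite lebesgue_rV_box// ltry.
Qed.

End row_vectors.
Import ComplexField.Normc.

(** * Complex numbers and complex-valued measurable functions *)

Section complex_modulus.
Context {R : realType}.
Implicit Types z w : R[i].
Local Notation Re := (@complex.Re R).
Local Notation Im := (@complex.Im R).

Lemma normcE z : normc z = Num.sqrt (Re z ^+ 2 + Im z ^+ 2).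
Proof. by case: z. Qed.

Lemma normc_ge0 z : 0 <= normc z.
Proof. by rewrite normcE sqrtr_ge0. Qed.

Lemma sqr_normcE z : normc z ^+ 2 = Re z ^+ 2 + Im z ^+ 2.
Proof. by rewrite normcE sqr_sqrtr// addr_ge0 ?sqr_ge0. Qed.

Lemma normc_conj z : normc (conjc z) = normc z.
Proof. by case: z => a b; rewrite !normcE/= sqrrN. Qed.

Lemma ler_normcD z w : normc (z + w) <= normc z + normc w.
Proof. exact: le_normcD. Qed.

Lemma normc_opp z : normc (- z) = normc z.
Proof. by case: z => a b; rewrite !normcE/= !sqrrN. Qed.

Lemma normc_real (r : R) : normc (r%:C)%C = `|r|.
Proof. by rewrite normcE/= expr0n addr0 sqrtr_sqr. Qed.

Lemma ler_normc_sum (T : Type) (s : seq T) (F : T -> R[i]) :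
  normc (\sum_(i <- s) F i) <= \sum_(i <- s) normc (F i).
Proof.
elim: s => [|i s IH]; first by rewrite !big_nil normcE/= expr0n addr0 sqrtr0.
by rewrite !big_cons (le_trans (ler_normcD _ _))// lerD2l.
Qed.

Lemma normc_Re z : `|Re z| <= normc z.
Proof.
rewrite -(@ler_pXn2r _ 2)// ?nnegrE ?normc_ge0//.
by rewrite sqr_normcE real_normK ?num_real// lerDl sqr_ge0.
Qed.

Lemma normc_Im z : `|Im z| <= normc z.
Proof.
rewrite -(@ler_pXn2r _ 2)// ?nnegrE ?normc_ge0//.
by rewrite sqr_normcE real_normK ?num_real// lerDr sqr_ge0.
Qed.

Lemma Re_add z w : Re (z + w) = Re z + Re w. Proof. by case: z w => ? ? []. Qed.
Lemma Im_add z w : Im (z + w) = Im z + Im w. Proof. by case: z w => ? ? []. Qed.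
Lemma Re_opp z : Re (- z) = - Re z. Proof. by case: z. Qed.
Lemma Im_opp z : Im (- z) = - Im z. Proof. by case: z. Qed.
Lemma Re_mul z w : Re (z * w) = Re z * Re w - Im z * Im w.
Proof. by case: z w => ? ? []. Qed.
Lemma Im_mul z w : Im (z * w) = Re z * Im w + Im z * Re w.
Proof. by case: z w => ? ? []. Qed.
Lemma Re_conj z : Re (conjc z) = Re z. Proof. by case: z. Qed.
Lemma Im_conj z : Im (conjc z) = - Im z. Proof. by case: z. Qed.

Lemma complex_eqP z w : Re z = Re w -> Im z = Im w -> z = w.
Proof. by case: z w => ? ? [? ?] /= -> ->. Qed.

Lemma conjcM z w : conjc (z * w) = conjc z * conjc w.
Proof. exact: rmorphM. Qed.

Lemma mul_conjc z : z * conjc z = ((normc z ^+ 2)%:C)%C.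
Proof.
apply: complex_eqP; rewrite ?Re_mul ?Im_mul Re_conj Im_conj/= ?sqr_normcE.
  by rewrite mulrN opprK -!expr2.
by rewrite mulrN mulrC addNr.
Qed.

End complex_modulus.

Section complex_measurable.
Context {R : realType} {n : nat} (Omega : set 'rV[R]_n).
Local Notation Rn := 'rV[R]_n.
Local Notation C := R[i].
Implicit Types (f g : Rn -> C).
Local Notation cmeas := (cmeasurable_fun Omega).

Lemma cmeasurable_cst (c : C) : cmeas (fun=> c).
Proof. by split; exact: measurable_cst. Qed.

Lemma cmeasurableD f g : cmeas f -> cmeas g -> cmeas (fun x => f x + g x).
Proof.
move=> [f1 f2] [g1 g2]; split.
  by under eq_fun do rewrite Re_add; exact: measurable_funD.
by under eq_fun do rewrite Im_add; exact: measurable_funD.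
Qed.

Lemma cmeasurableN f : cmeas f -> cmeas (fun x => - f x).
Proof.
move=> [f1 f2]; split.
  by under eq_fun do rewrite Re_opp; exact: measurableT_comp.
by under eq_fun do rewrite Im_opp; exact: measurableT_comp.
Qed.

Lemma cmeasurableB f g : cmeas f -> cmeas g -> cmeas (fun x => f x - g x).
Proof. by move=> mf mg; apply: cmeasurableD => //; exact: cmeasurableN. Qed.

Lemma cmeasurableM f g : cmeas f -> cmeas g -> cmeas (fun x => f x * g x).
Proof.
move=> [f1 f2] [g1 g2]; split.
  under eq_fun do rewrite Re_mul.
  by apply: measurable_funB; exact: measurable_funM.
under eq_fun do rewrite Im_mul.
by apply: measurable_funD; exact: measurable_funM.
Qed.

Lemma cmeasurable_conj f : cmeas f -> cmeas (fun x => conjc (f x)).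
Proof.
move=> [f1 f2]; split; first by under eq_fun do rewrite Re_conj.
by under eq_fun do rewrite Im_conj; exact: measurableT_comp.
Qed.

Lemma cmeasurable_sum (T : eqType) (s : seq T) (F : T -> Rn -> C) :
  (forall i, i \in s -> cmeas (F i)) -> cmeas (fun x => \sum_(i <- s) F i x).
Proof.
elim: s => [|i s IH] mF.
  by under eq_fun do rewrite big_nil; exact: cmeasurable_cst.
under eq_fun do rewrite big_cons; apply: cmeasurableD.
  by apply: mF; rewrite mem_head.
by apply: IH => k ks; apply: mF; rewrite inE ks orbT.
Qed.

Lemma cmeasurable_if (P : Rn -> bool) f g : measurable Omega ->
  measurable_fun Omega P -> cmeas f -> cmeas g ->
  cmeas (fun x => if P x then f x else g x).
Proof.
move=> mO mP [f1 f2] [g1 g2]; split.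
  under eq_fun do rewrite (fun_if (@complex.Re R)).
  by apply: measurable_fun_if => //; exact: measurable_funS (@subIsetl _ _ _) _.
under eq_fun do rewrite (fun_if (@complex.Im R)).
by apply: measurable_fun_if => //; exact: measurable_funS (@subIsetl _ _ _) _.
Qed.

Lemma cmeasurable_real (h : Rn -> R) : measurable_fun Omega h ->
  cmeas (fun x => (h x)%:C%C).
Proof. by move=> mh; split => //; exact: measurable_cst. Qed.

Lemma measurable_normc f : cmeas f -> measurable_fun Omega (fun x => normc (f x)).
Proof.
move=> [f1 f2]; under eq_fun do rewrite normcE -powR12_sqrt ?addr_ge0 ?sqr_ge0//.
apply: (measurableT_comp (measurable_powR _)).
by apply: measurable_funD; exact: measurable_funX.
Qed.

Lemma measurable_normc_powR f r : cmeas f ->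
  measurable_fun Omega (fun x => normc (f x) `^ r).
Proof.
by move=> mf; apply: (measurableT_comp (measurable_powR _)); exact: measurable_normc.
Qed.

End complex_measurable.
(** * Moments and integrals of complex-valued functions *)

Section moments.
Context {R : realType} {n : nat} (Omega : set 'rV[R]_n).
Hypothesis mOmega : measurable Omega.
Local Notation Rn := 'rV[R]_n.
Local Notation C := R[i].
Local Notation mu := (@lebesgue_rV R n).
Local Notation cmeas := (cmeasurable_fun Omega).
Implicit Types (f g : Rn -> C).

(** The [r]-th power of the L^r norm: it is additive over the domain and takes
    part in sums of integrals, which the norm itself does not. *)
Definition moment (r : R) f : \bar R :=
  (\int[mu]_(x in Omega) (normc (f x) `^ r)%:E)%E.

Lemma moment_ge0 r f : (0 <= moment r f)%E.
Proof. by apply: integral_ge0 => x _; rewrite lee_fin powR_ge0. Qed.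

Lemma moment_fineK r f : (moment r f < +oo)%E ->
  (fine (moment r f))%:E = moment r f.
Proof. by move=> foo; rewrite fineK// ge0_fin_numE ?moment_ge0. Qed.

Lemma moment1E f : moment 1 f = (\int[mu]_(x in Omega) (normc (f x))%:E)%E.
Proof. by apply: eq_integral => x _; rewrite powRr1 ?normc_ge0. Qed.

Lemma moment2E f : moment 2 f = (\int[mu]_(x in Omega) (normc (f x) ^+ 2)%:E)%E.
Proof. by apply: eq_integral => x _; rewrite powR_mulrn ?normc_ge0. Qed.

Lemma LpN_moment r f : 0 < r -> LpN Omega r%:E f = (moment r f `^ r^-1)%E.
Proof.
move=> r0; rewrite /LpN unlock; congr (_ `^ _)%E.
rewrite /moment [RHS]integral_mkcond; apply: eq_integral => x _.
rewrite /patch; case: ifPn => _ /=; last by rewrite normr0 powR0 ?gt_eqF.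
by rewrite ger0_norm ?normc_ge0.
Qed.

Lemma poweR_LpN r f : 0 < r -> (LpN Omega r%:E f `^ r)%E = moment r f.
Proof.
by move=> r0; rewrite LpN_moment// -poweRrM mulVf ?gt_eqF// poweRe1 ?moment_ge0.
Qed.

Lemma memLp_moment r f : 0 < r ->
  memLp Omega r%:E f <-> cmeas f /\ (moment r f < +oo)%E.
Proof.
move=> r0; rewrite /memLp; split=> -[mf foo]; split=> //.
  by rewrite -poweR_LpN// poweR_lty.
by rewrite LpN_moment// poweR_lty.
Qed.

Lemma le_moment r f g : 0 <= r -> cmeas f -> cmeas g ->
  (forall x, Omega x -> normc (f x) <= normc (g x)) ->
  (moment r f <= moment r g)%E.
Proof.
move=> r0 mf mg fg; apply: ge0_le_integral => //.
- by move=> x _; rewrite lee_fin powR_ge0.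
- by apply/measurable_EFinP; exact: measurable_normc_powR.
- by apply/measurable_EFinP; exact: measurable_normc_powR.
- by move=> x Ox; rewrite lee_fin powR_homo_ge0 ?normc_ge0 ?fg.
Qed.

Definition cintegrable f := cmeas f /\ (moment 1 f < +oo)%E.

Lemma cintegrable_Re f : cintegrable f ->
  mu.-integrable Omega (EFin \o (fun x => complex.Re (f x))).
Proof.
move=> [mf foo]; apply/integrableP; split; first by apply/measurable_EFinP; case: mf.
apply: le_lt_trans foo; rewrite moment1E; apply: ge0_le_integral => //.
- by apply: measurableT_comp => //; apply/measurable_EFinP; case: mf.
- by apply/measurable_EFinP; exact: measurable_normc.
- by move=> x _; rewrite lee_fin normc_Re.
Qed.

Lemma cintegrable_Im f : cintegrable f ->
  mu.-integrable Omega (EFin \o (fun x => complex.Im (f x))).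
Proof.
move=> [mf foo]; apply/integrableP; split; first by apply/measurable_EFinP; case: mf.
apply: le_lt_trans foo; rewrite moment1E; apply: ge0_le_integral => //.
- by apply: measurableT_comp => //; apply/measurable_EFinP; case: mf.
- by apply/measurable_EFinP; exact: measurable_normc.
- by move=> x _; rewrite lee_fin normc_Im.
Qed.

Lemma cintegrable_normc f : cintegrable f ->
  mu.-integrable Omega (EFin \o (fun x => normc (f x))).
Proof.
move=> [mf foo]; apply/integrableP; split.
  by apply/measurable_EFinP; exact: measurable_normc.
move: foo; rewrite moment1E; congr (_ < _)%E; apply: eq_integral => x _ /=.
by rewrite ger0_norm ?normc_ge0.
Qed.

Lemma cintegrableD f g : cintegrable f -> cintegrable g ->
  cintegrable (fun x => f x + g x).
Proof.
move=> [mf foo] [mg goo]; split; first exact: cmeasurableD.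
apply: le_lt_trans (lte_add_pinfty foo goo); rewrite !moment1E -ge0_integralD//.
- apply: ge0_le_integral => //.
  + by move=> x _; rewrite lee_fin normc_ge0.
  + by apply/measurable_EFinP; apply: measurable_normc; exact: cmeasurableD.
  + by apply/emeasurable_funD; apply/measurable_EFinP; exact: measurable_normc.
  + by move=> x _; rewrite -EFinD lee_fin ler_normcD.
- by move=> x _; rewrite lee_fin normc_ge0.
- by apply/measurable_EFinP; exact: measurable_normc.
- by move=> x _; rewrite lee_fin normc_ge0.
- by apply/measurable_EFinP; exact: measurable_normc.
Qed.

Lemma cintegrableZ (c : C) f : cintegrable f -> cintegrable (fun x => c * f x).
Proof.
move=> [mf foo]; have mcf : cmeas (fun x => c * f x).
  by apply: cmeasurableM => //; exact: cmeasurable_cst.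
split; first by [].
rewrite moment1E.
under eq_integral do rewrite normcM EFinM.
rewrite ge0_integralZl_EFin ?normc_ge0//; last 2 first.
- by move=> x _; rewrite lee_fin normc_ge0.
- by apply/measurable_EFinP; exact: measurable_normc.
by rewrite -moment1E -(moment_fineK foo) -EFinM ltry.
Qed.

Lemma cintegrable0 : cintegrable (fun=> 0).
Proof.
split; first exact: cmeasurable_cst.
by rewrite moment1E integral0_eq// => x _; rewrite (@normc0 R).
Qed.

Lemma cintegrable_sum (T : eqType) (s : seq T) (F : T -> Rn -> C) :
  (forall i, i \in s -> cintegrable (F i)) ->
  cintegrable (fun x => \sum_(i <- s) F i x).
Proof.
elim: s => [|i s IH] iF.
  by under eq_fun do rewrite big_nil; exact: cintegrable0.
under eq_fun do rewrite big_cons.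
apply: (cintegrableD (iF i (mem_head _ _))).
by apply: IH => k ks; apply: iF; rewrite inE ks orbT.
Qed.

Lemma cintegralD f g : cintegrable f -> cintegrable g ->
  cintegral Omega (fun x => f x + g x) = cintegral Omega f + cintegral Omega g.
Proof.
move=> iF iG; apply: complex_eqP => /=.
  under eq_Rintegral do rewrite Re_add.
  by rewrite RintegralD//; exact: cintegrable_Re.
under eq_Rintegral do rewrite Im_add.
by rewrite RintegralD//; exact: cintegrable_Im.
Qed.

Lemma integrableZ_EFin (c : R) (h : Rn -> R) :
  mu.-integrable Omega (EFin \o h) ->
  mu.-integrable Omega (EFin \o (fun x => c * h x)).
Proof.
move=> ih; rewrite (_ : _ \o _ = (fun x => c%:E * (EFin \o h) x)%E).
  exact: integrableZl.
by apply/funext => x /=; rewrite EFinM.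
Qed.

Lemma cintegralZ (c : C) f : cintegrable f ->
  cintegral Omega (fun x => c * f x) = c * cintegral Omega f.
Proof.
move=> iF; have iRe := cintegrable_Re iF; have iIm := cintegrable_Im iF.
apply: complex_eqP; rewrite ?Re_mul ?Im_mul/=.
  under eq_Rintegral do rewrite Re_mul.
  by rewrite RintegralB ?RintegralZl//; exact: integrableZ_EFin.
under eq_Rintegral do rewrite Im_mul.
by rewrite RintegralD ?RintegralZl//; exact: integrableZ_EFin.
Qed.

Lemma cintegral_sum (T : eqType) (s : seq T) (F : T -> Rn -> C) :
  (forall i, i \in s -> cintegrable (F i)) ->
  cintegral Omega (fun x => \sum_(i <- s) F i x) =
  \sum_(i <- s) cintegral Omega (F i).
Proof.
elim: s => [|i s IH] iF.
  rewrite big_nil; apply: complex_eqP => /=;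
    by rewrite /Rintegral integral0_eq// => x _; rewrite big_nil.
have {}IH := IH (fun k ks => iF k (mem_behead (s := i :: s) ks)).
have iFs : cintegrable (fun x => \sum_(k <- s) F k x).
  by apply: cintegrable_sum => k ks; apply: iF; rewrite inE ks orbT.
rewrite big_cons -IH -(cintegralD (iF i (mem_head _ _)) iFs).
by congr cintegral; apply/funext => x; rewrite big_cons.
Qed.

Lemma eq_cintegral f g : (forall x, Omega x -> f x = g x) ->
  cintegral Omega f = cintegral Omega g.
Proof.
by move=> fg; apply: complex_eqP => /=; apply: eq_Rintegral => x;
  rewrite inE => /fg ->.
Qed.

(** Multiplying by the conjugate of the integral turns its modulus into the
    integral of a real part, to which the real inequality applies. *)
Lemma normc_cintegral f : cmeas f ->
  ((normc (cintegral Omega f))%:E <= moment 1 f)%E.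
Proof.
move=> mf; have [foo|] := ltP (moment 1 f) +oo%E;
  last by rewrite leye_eq => /eqP ->; rewrite leey.
have iF : cintegrable f by [].
have iRe := cintegrable_Re iF; have iIm := cintegrable_Im iF.
set z := cintegral Omega f.
have [->|z0] := eqVneq z 0; first by rewrite (@normc0 R) moment_ge0.
have nz : 0 < normc z.
  by rewrite lt_neqAle normc_ge0 andbT eq_sym; apply: contra z0 => /eqP/eq0_normc ->.
have rotate (w : C) : complex.Re w * \int[mu]_(x in Omega) complex.Re (f x) +
    complex.Im w * \int[mu]_(x in Omega) complex.Im (f x) <=
    normc w * \int[mu]_(x in Omega) normc (f x).
  rewrite -!RintegralZl//; last exact: cintegrable_normc.
  rewrite -RintegralD//; last 2 first.
  - exact: integrableZ_EFin.
  - exact: integrableZ_EFin.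
  apply: le_Rintegral => //.
  - have := integrableD mOmega (integrableZ_EFin (complex.Re w) iRe)
      (integrableZ_EFin (complex.Im w) iIm).
    by apply: eq_integrable.
  - by apply: integrableZ_EFin; exact: cintegrable_normc.
  move=> x _; have -> : complex.Re w * complex.Re (f x) +
      complex.Im w * complex.Im (f x) = complex.Re (conjc w * f x).
    by rewrite Re_mul Re_conj Im_conj mulNr opprK.
  by rewrite -(normc_conj w) -normcM (le_trans (ler_norm _)) ?normc_Re.
rewrite -(moment_fineK foo) lee_fin -(ler_pM2l nz) -expr2 moment1E.
by apply: le_trans (rotate z); rewrite sqr_normcE !expr2.
Qed.

End moments.
(** * Inner products on a set of finite measure *)

Section inner_products.
Context {R : realType} {n : nat} (Omega : set 'rV[R]_n).
Hypothesis mOmega : measurable Omega.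
Hypothesis finOmega : (lebesgue_rV n Omega < +oo)%E.
Local Notation Rn := 'rV[R]_n.
Local Notation C := R[i].
Local Notation mu := (@lebesgue_rV R n).
Local Notation cmeas := (cmeasurable_fun Omega).
Local Notation moment := (moment Omega).
Local Notation cintegrable := (cintegrable Omega).
Local Notation inner := (inner Omega).
Implicit Types (f g h : Rn -> C).

Lemma cmeasurable_mul_conj f g : cmeas f -> cmeas g ->
  cmeas (fun x => f x * conjc (g x)).
Proof. by move=> mf mg; apply: cmeasurableM => //; exact: cmeasurable_conj. Qed.

Lemma moment1_mul_conj_le t f g : 0 < t -> cmeas f -> cmeas g ->
  (moment 1 (fun x => f x * conjc (g x))%R <=
    (t / 2)%:E * moment 2 f + (t^-1 / 2)%:E * moment 2 g)%E.
Proof.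
move=> t0 mf mg; rewrite moment1E !moment2E.
have m2 k : cmeas k ->
    measurable_fun Omega (fun x => (normc (k x) ^+ 2)%:E).
  by move=> mk; apply/measurable_EFinP/measurable_funX; exact: measurable_normc.
have nn k (x : Rn) : Omega x -> (0 <= (normc (k x : C) ^+ 2)%:E)%E.
  by move=> _; rewrite lee_fin sqr_ge0.
rewrite -!ge0_integralZl_EFin ?divr_ge0 ?invr_ge0 ?(ltW t0)//; last 4 first.
- exact: nn.
- exact: m2.
- exact: nn.
- exact: m2.
rewrite -ge0_integralD//; last 4 first.
- by move=> x Ox; rewrite mule_ge0 ?nn// lee_fin divr_ge0// ltW.
- by apply: measurable_funeM; exact: m2.
- by move=> x Ox; rewrite mule_ge0 ?nn// lee_fin divr_ge0// invr_ge0 ltW.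
- by apply: measurable_funeM; exact: m2.
apply: ge0_le_integral => //.
- by move=> x _; rewrite lee_fin normc_ge0.
- by apply/measurable_EFinP; exact: measurable_normc (cmeasurable_mul_conj mf mg).
- by apply: emeasurable_funD; apply: measurable_funeM; exact: m2.
move=> x _; rewrite -!EFinM -EFinD lee_fin normcM normc_conj.
set a := normc (f x); set b := normc (g x).
rewrite -subr_ge0 [X in 0 <= X](_ : _ = t / 2 * (a - t^-1 * b) ^+ 2).
  by rewrite mulr_ge0 ?sqr_ge0// divr_ge0// ltW.
by field; rewrite gt_eqF.
Qed.

Lemma lte_mul_EFin (r : R) (y : \bar R) : 0 <= r -> (y < +oo)%E ->
  (r%:E * y < +oo)%E.
Proof. by move=> r0 yoo; apply: lte_mul_pinfty; rewrite ?lee_fin. Qed.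

Lemma cintegrable_mul_conj f g : cmeas f -> cmeas g ->
  (moment 2 f < +oo)%E -> (moment 2 g < +oo)%E ->
  cintegrable (fun x => f x * conjc (g x)).
Proof.
move=> mf mg foo goo; split; first exact: cmeasurable_mul_conj.
apply: (le_lt_trans (moment1_mul_conj_le ltr01 mf mg)).
have half0 : 0 <= 1 / 2 :> R by rewrite divr_ge0.
have half1 : 0 <= 1^-1 / 2 :> R by rewrite divr_ge0 ?invr_ge0.
exact: lte_add_pinfty (lte_mul_EFin half0 foo) (lte_mul_EFin half1 goo).
Qed.

(** Cauchy-Schwarz in its additive form: optimising over [t] gives back the
    product of the two norms, but a free [t] avoids square roots and can be
    matched to the constants at hand. *)
Lemma normc_inner_le t f g : 0 < t -> cmeas f -> cmeas g ->
  ((normc (inner f g))%:E <=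
    (t / 2)%:E * moment 2 f + (t^-1 / 2)%:E * moment 2 g)%E.
Proof.
move=> t0 mf mg; apply: le_trans (moment1_mul_conj_le t0 mf mg).
by apply: normc_cintegral => //; exact: cmeasurable_mul_conj.
Qed.

Lemma inner_sumr (T : eqType) (s : seq T) f (w : T -> Rn -> C) (c : T -> C) :
  (forall i, i \in s -> cintegrable (fun x => f x * conjc (w i x))) ->
  inner f (fun x => \sum_(i <- s) c i * w i x) =
  \sum_(i <- s) conjc (c i) * inner f (w i).
Proof.
move=> ifw; transitivity (cintegral Omega
    (fun x => \sum_(i <- s) conjc (c i) * (f x * conjc (w i x)))).
  apply: eq_cintegral => x _; rewrite rmorph_sum mulr_sumr.
  by apply: eq_bigr => i _; rewrite rmorphM mulrCA.
rewrite (cintegral_sum mOmega); last by move=> i /ifw; exact: (cintegrableZ mOmega).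
by apply: eq_big_seq => i /ifw iw; rewrite cintegralZ.
Qed.

Lemma inner_suml (T : eqType) (s : seq T) h (u : T -> Rn -> C) (c : T -> C) :
  (forall i, i \in s -> cintegrable (fun x => u i x * conjc (h x))) ->
  inner (fun x => \sum_(i <- s) c i * u i x) h =
  \sum_(i <- s) c i * inner (u i) h.
Proof.
move=> iuh; transitivity (cintegral Omega
    (fun x => \sum_(i <- s) c i * (u i x * conjc (h x)))).
  apply: eq_cintegral => x _; rewrite mulr_suml.
  by apply: eq_bigr => i _; rewrite mulrA.
rewrite (cintegral_sum mOmega); last by move=> i /iuh; exact: (cintegrableZ mOmega).
by apply: eq_big_seq => i /iuh iu; rewrite cintegralZ.
Qed.

Lemma normc_innerC f g : cintegrable (fun x => f x * conjc (g x)) ->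
  normc (inner g f) = normc (inner f g).
Proof.
move=> ifg; rewrite -normc_conj; congr normc.
apply: complex_eqP; rewrite ?Re_conj ?Im_conj/=.
  by apply: eq_Rintegral => x _; rewrite !Re_mul !Re_conj !Im_conj; ring.
rewrite -mulN1r -RintegralZl//.
- by apply: eq_Rintegral => x _; rewrite !Im_mul !Re_conj !Im_conj; ring.
- have := integrableZ_EFin mOmega (-1) (cintegrable_Im mOmega ifg).
  apply: eq_integrable => // x _ /=.
  by congr EFin; rewrite !Im_mul !Re_conj !Im_conj; ring.
Qed.

Lemma moment_bounded r k f : 0 <= r -> cmeas f ->
  (forall x, Omega x -> normc (f x) <= k) -> (moment r f < +oo)%E.
Proof.
move=> r0 mf fk.
apply: (@le_lt_trans _ _ (\int[mu]_(x in Omega) (`|k| `^ r)%:E)%E).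
  apply: ge0_le_integral => //.
  - by move=> x _; rewrite lee_fin powR_ge0.
  - by apply/measurable_EFinP; exact: measurable_normc_powR.
  - move=> x Ox; rewrite lee_fin powR_homo_ge0 ?normc_ge0//.
    by rewrite (le_trans (fk _ Ox))// ler_norm.
by rewrite integral_cst// lte_mul_pinfty ?lee_fin ?powR_ge0.
Qed.

Lemma moment1_lty r f : 1 <= r -> cmeas f -> (moment r f < +oo)%E ->
  (moment 1 f < +oo)%E.
Proof.
move=> r1 mf foo.
apply: (@le_lt_trans _ _ (\int[mu]_(x in Omega) (1 + (normc (f x) `^ r)%:E))%E).
  rewrite moment1E; apply: ge0_le_integral => //.
  - by move=> x _; rewrite lee_fin normc_ge0.
  - by apply/measurable_EFinP; exact: measurable_normc.
  - apply: emeasurable_funD => //.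
    by apply/measurable_EFinP; exact: measurable_normc_powR.
  - move=> x Ox; rewrite -EFinD lee_fin.
    have [f1|f1] := leP (normc (f x)) 1.
      by rewrite (le_trans f1)// lerDl powR_ge0.
    by rewrite (le_trans (le1r_powR (ltW f1) r1))// lerDr.
rewrite ge0_integralD//; last 2 first.
- by move=> x _; rewrite lee_fin powR_ge0.
- by apply/measurable_EFinP; exact: measurable_normc_powR.
by rewrite lte_add_pinfty// integral_cst// mul1e.
Qed.

Lemma moment1_mul_conj_ae W f w : 0 <= W -> cmeas f -> cmeas w ->
  (\forall x \ae mu, Omega x -> normc (w x) <= W) ->
  (moment 1 (fun x => f x * conjc (w x))%R <= W%:E * moment 1 f)%E.
Proof.
move=> W0 mf mw wW; rewrite !moment1E.
rewrite -ge0_integralZl_EFin//; last 2 first.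
- by move=> x _; rewrite lee_fin normc_ge0.
- by apply/measurable_EFinP; exact: measurable_normc.
apply: ae_ge0_le_integral => //.
- by move=> x _; rewrite lee_fin normc_ge0.
- by apply/measurable_EFinP; exact: measurable_normc (cmeasurable_mul_conj mf mw).
- by move=> x _; rewrite mule_ge0// lee_fin normc_ge0.
- by apply: measurable_funeM; apply/measurable_EFinP; exact: measurable_normc.
apply: filterS wW => x /[apply] wW.
by rewrite normcM normc_conj mulrC -EFinM lee_fin ler_wpM2r ?normc_ge0.
Qed.

Lemma LpNy_ae f : (LpN Omega +oo%E f < +oo)%E ->
  \forall x \ae mu, Omega x -> normc (f x) <= fine (LpN Omega +oo%E f).
Proof.
move=> foo; have N0 : (0 <= LpN Omega +oo%E f)%E by exact: Lnorm_ge0.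
have [mu0|mu0] := leP (mu setT) 0%E.
  by exists setT; split => //; apply/eqP; rewrite eq_le measure_ge0 andbT.
have := @ess_sup_ge _ _ _ mu (abse \o ((fun x => (normc (f x))%:E) \_ Omega))%E.
apply: filterS => x /= fx Ox; rewrite -lee_fin fineK ?ge0_fin_numE//.
rewrite /LpN unlock mu0; apply: le_trans fx; rewrite /patch mem_set//=.
by rewrite lee_fin ler_norm.
Qed.

Lemma LpNy_le M f : 0 <= M ->
  (\forall x \ae mu, Omega x -> normc (f x) <= M) ->
  (LpN Omega +oo%E f <= M%:E)%E.
Proof.
move=> M0 fM; rewrite /LpN unlock; case: ifPn => // _.
apply/ess_supP; apply: filterS fM => x fM /=; rewrite /patch.
case: ifPn => [/set_mem Ox|_]; last by rewrite abse0.
by rewrite /= ger0_norm ?normc_ge0// lee_fin fM.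
Qed.

End inner_products.
(** * Bessel's inequality and interpolation *)

Section bessel_families.
Context {R : realType} {n : nat} (Omega : set 'rV[R]_n).
Hypothesis mOmega : measurable Omega.
Hypothesis finOmega : (lebesgue_rV n Omega < +oo)%E.
Context {K : nat} (I : set 'rV[int]_K).
Local Notation Rn := 'rV[R]_n.
Local Notation ZK := 'rV[int]_K.
Local Notation C := R[i].
Local Notation mu := (@lebesgue_rV R n).
Local Notation cmeas := (cmeasurable_fun Omega).
Local Notation moment := (moment Omega).
Local Notation cintegrable := (cintegrable Omega).
Implicit Types (f g h : Rn -> C) (A : {fset ZK}) (c : ZK -> C).

Variables (w : ZK -> Rn -> C) (W : ZK -> R) (B : R).
Hypothesis mw : forall xi, I xi -> cmeas (w xi).
Hypothesis w2 : forall xi, I xi -> (moment 2 (w xi) < +oo)%E.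
Hypothesis W_ge0 : forall xi, 0 <= W xi.
Hypothesis W_gt0 : forall xi, I xi -> 0 < W xi.
Hypothesis wW : forall xi, I xi -> \forall x \ae mu, Omega x -> normc (w xi x) <= W xi.
Hypothesis B_gt0 : 0 < B.
Hypothesis w_upper : forall A c, [set` A] `<=` I ->
  (moment 2 (lincomb A c w) <= (B * \sum_(xi <- A) normc (c xi) ^+ 2)%:E)%E.

Lemma cmeasurable_lincomb A c : [set` A] `<=` I -> cmeas (lincomb A c w).
Proof.
move=> AI; apply: cmeasurable_sum => xi xiA; apply: cmeasurableM.
  exact: cmeasurable_cst.
by apply: mw; exact: AI.
Qed.

(** Pairing [f] with the combination of the [w xi] whose coefficients are the
    Fourier coefficients of [f] gives the sum [S] of their squares, while the
    combination itself has squared norm at most [B * S]; Cauchy-Schwarz with the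
    parameter [B] then absorbs half of [S]. *)
Lemma bessel_le A f : [set` A] `<=` I -> cmeas f -> (moment 2 f < +oo)%E ->
  ((\sum_(xi <- A) normc (fourier Omega w f xi) ^+ 2)%:E <= B%:E * moment 2 f)%E.
Proof.
move=> AI mf foo; set s := fourier Omega w f; set S := \sum_(xi <- A) _.
have S0 : 0 <= S by apply: sumr_ge0 => i _; exact: sqr_ge0.
have innerE : inner Omega f (lincomb A s w) = (S%:C)%C.
  rewrite (inner_sumr mOmega); last first.
    move=> xi xiA; have Ixi := AI _ xiA.
    exact: (cintegrable_mul_conj mOmega mf (mw Ixi) foo (w2 Ixi)).
  rewrite /S rmorph_sum; apply: eq_bigr => xi _.
  by rewrite mulrC -[inner _ _ _]/(s xi) mul_conjc.
have := normc_inner_le mOmega B_gt0 mf (cmeasurable_lincomb s AI).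
rewrite innerE normc_real ger0_norm//.
have F := moment_fineK foo.
move=> /le_trans/(_ (leeD2l _ (lee_wpmul2l _ (w_upper s AI)))).
rewrite -F -!EFinM -EFinD !lee_fin => /(_ _)/wrap[].
  by rewrite divr_ge0 ?invr_ge0 ?(ltW B_gt0).
rewrite -/S [B^-1 / 2 * _](_ : _ = S / 2); last by field; rewrite gt_eqF.
by rewrite [B / 2 * _](_ : _ = B * fine (moment 2 f) / 2); [lra|field].
Qed.

Lemma cintegrable_mul_conj_w xi f : I xi -> cintegrable f ->
  cintegrable (fun x => f x * conjc (w xi x)).
Proof.
move=> Ixi [mf foo]; split; first by apply: cmeasurable_mul_conj => //; exact: mw.
apply: (le_lt_trans (moment1_mul_conj_ae mOmega (W_ge0 xi) mf (mw Ixi) (wW Ixi))).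
by apply: lte_mul_pinfty; rewrite ?lee_fin.
Qed.

Lemma normc_fourier_le xi f : I xi -> cmeas f ->
  ((normc (fourier Omega w f xi))%:E <= (W xi)%:E * moment 1 f)%E.
Proof.
move=> Ixi mf.
apply: le_trans (moment1_mul_conj_ae mOmega (W_ge0 xi) mf (mw Ixi) (wW Ixi)).
by apply: normc_cintegral => //; apply: cmeasurable_mul_conj => //; exact: mw.
Qed.

Section marcinkiewicz.
Variables (p N : R) (f : Rn -> C).
Hypotheses (p1 : 1 < p) (N0 : 0 < N) (mf : cmeas f).
Hypothesis fN : (moment p f <= N%:E)%E.

(* The cut at level [t]; it is chosen so that the large part of [f] has L^1 norm
   at most [t / 2]. *)
Let small t x := t * normc (f x) `^ (p - 1) <= 2 * N.
Let fs t x : C := if small t x then f x else 0.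
Let fb t x : C := if small t x then 0 else f x.

Let msmall t : measurable_fun Omega (small t).
Proof.
apply: measurable_fun_ler; last exact: measurable_cst.
apply: measurable_funM; first exact: measurable_cst.
exact: measurable_normc_powR.
Qed.

Let mfs t : cmeas (fs t).
Proof. by apply: cmeasurable_if => //; exact: cmeasurable_cst. Qed.

Let mfb t : cmeas (fb t).
Proof. by apply: cmeasurable_if => //; exact: cmeasurable_cst. Qed.

Let f1 : (moment 1 f < +oo)%E.
Proof.
by apply: (moment1_lty mOmega finOmega (ltW p1) mf); rewrite (le_lt_trans fN) ?ltry.
Qed.

Let ifs t : cintegrable (fs t).
Proof.
split; first by [].
apply: le_lt_trans f1; apply: (le_moment mOmega ler01 (mfs t) mf) => x _.
by rewrite /fs; case: ifP => // _; rewrite (@normc0 R) normc_ge0.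
Qed.

Let ifb t : cintegrable (fb t).
Proof.
split; first by [].
apply: le_lt_trans f1; apply: (le_moment mOmega ler01 (mfb t) mf) => x _.
by rewrite /fb; case: ifP => // _; rewrite (@normc0 R) normc_ge0.
Qed.

Let fs_moment2 t : 0 < t -> (moment 2 (fs t) < +oo)%E.
Proof.
move=> t0; apply: (moment_bounded mOmega finOmega (k := (2 * N / t) `^ (p - 1)^-1)) => //.
move=> x _; rewrite /fs; case: ifPn => [|_]; last by rewrite (@normc0 R) powR_ge0.
rewrite /small mulrC -ler_pdivlMr// => fx.
have pB : p - 1 != 0 by rewrite subr_eq0 gt_eqF.
have -> : normc (f x) = (normc (f x) `^ (p - 1)) `^ (p - 1)^-1.
  by rewrite -powRrM divff// powRr1 ?normc_ge0.
by apply: powR_homo_ge0; rewrite ?powR_ge0// invr_ge0 subr_ge0 ltW.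
Qed.

(* On the large part [normc f <= t / (2 * N) * normc f ^ p]. *)
Let fb_moment1 t : 0 < t -> (moment 1 (fb t) <= (t / 2)%:E)%E.
Proof.
move=> t0; apply: (@le_trans _ _ ((t / (2 * N))%:E * moment p f)%E); last first.
  apply: (le_trans (lee_wpmul2l _ fN)).
    by rewrite lee_fin divr_ge0 ?mulr_ge0 ?ltW.
  by rewrite -EFinM lee_fin le_eqVlt; apply/orP; left; apply/eqP; field; rewrite gt_eqF.
rewrite -ge0_integralZl_EFin//; last 3 first.
- by move=> x _; rewrite lee_fin powR_ge0.
- by apply/measurable_EFinP; exact: measurable_normc_powR.
- by rewrite divr_ge0 ?mulr_ge0 ?ltW.
rewrite moment1E; apply: ge0_le_integral => //.
- by move=> x _; rewrite lee_fin normc_ge0.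
- by apply/measurable_EFinP; exact: measurable_normc.
- by apply: measurable_funeM; apply/measurable_EFinP; exact: measurable_normc_powR.
move=> x _; rewrite -EFinM lee_fin /fb; case: ifPn => [_|].
  by rewrite (@normc0 R) mulr_ge0 ?powR_ge0// divr_ge0 ?mulr_ge0 ?ltW.
rewrite /small -ltNge => fx; rewrite mulrAC ler_pdivlMr ?mulr_gt0//.
rewrite -(@mulr_powRB1 _ _ p) ?normc_ge0 ?(lt_trans _ p1)// (mulrCA t).
by apply: ler_wpM2l (normc_ge0 _) _ _ _; exact: ltW.
Qed.

(** Where the normalised coefficient reaches [t], the large part of [f] accounts
    for at most half of it, so the coefficient of the small part is at least half
    as big, and Bessel's inequality counts such indices. *)
Lemma weak_type_le t A : 0 < t -> [set` A] `<=` I ->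
  ((\sum_(xi <- A | t <= normc (fourier Omega w f xi) / W xi)
      normc (fourier Omega w f xi) ^+ 2)%:E <= (4 * B)%:E * moment 2 (fs t))%E.
Proof.
move=> t0 AI.
apply: (@le_trans _ _ (4%:E *
    (\sum_(xi <- A) normc (fourier Omega w (fs t) xi) ^+ 2)%:E)%E); last first.
  rewrite EFinM -muleA; apply: lee_wpmul2l; first by rewrite lee_fin.
  exact: (bessel_le AI (mfs t) (fs_moment2 t0)).
rewrite -EFinM lee_fin mulr_sumr big_mkcond big_seq [leRHS]big_seq.
apply: ler_sum => xi xiA; have Ixi := AI _ xiA.
case: ifPn => [tle|_]; last by rewrite mulr_ge0 ?sqr_ge0.
have fE : fourier Omega w f xi = fourier Omega w (fs t) xi + fourier Omega w (fb t) xi.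
  rewrite /fourier /inner -(cintegralD mOmega (cintegrable_mul_conj_w Ixi (ifs t))
    (cintegrable_mul_conj_w Ixi (ifb t))).
  apply: eq_cintegral => x _; rewrite /fs /fb.
  by case: ifPn => _; rewrite mul0r ?addr0 ?add0r.
have bE : normc (fourier Omega w (fb t) xi) <= W xi * (t / 2).
  rewrite -lee_fin (le_trans (normc_fourier_le Ixi (mfb t)))// EFinM.
  by rewrite lee_wpmul2l ?lee_fin ?fb_moment1.
have := ler_normcD (fourier Omega w (fs t) xi) (fourier Omega w (fb t) xi).
rewrite -fE; move: tle; rewrite ler_pdivlMr ?W_gt0// => tle fle.
have s2 : normc (fourier Omega w f xi) <= 2 * normc (fourier Omega w (fs t) xi).
  by move: bE; rewrite mulrCA; lra.
have -> : 4 = 2 ^+ 2 :> R by ring.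
by rewrite -exprMn ler_pXn2r// nnegrE ?mulr_ge0 ?normc_ge0.
Qed.

Hypothesis p2 : p < 2.
Let q := p / (p - 1).
Let al := q - 2.
Let D : R := (2 `^ al) ^+ 2 / (2 `^ al - 1).

Let pB_gt0 : 0 < p - 1. Proof. by rewrite subr_gt0. Qed.

Let al_gt0 : 0 < al.
Proof. by rewrite subr_gt0 ltr_pdivlMr//; have := p2; lra. Qed.

Let D_ge0 : 0 <= D.
Proof. by rewrite divr_ge0 ?sqr_ge0// subr_ge0 ltW// powR2_gt1. Qed.

Let alE : (p - 1) * al = 2 - p.
Proof. by rewrite /al /q; field; rewrite gt_eqF. Qed.

(* At a fixed point the levels for which [f x] is in the small part form an
   initial segment, which ends at [2 * N / normc (f x) `^ (p - 1)]. *)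
Let pointwise t J x : 0 < t ->
  \sum_(j < J) (t * 2 ^+ j.+1) `^ al * normc (fs (t * 2 ^+ j) x) ^+ 2 <=
  D * (2 * N) `^ al * normc (f x) `^ p.
Proof.
move=> t0.
have [fx0|fx0] := eqVneq (normc (f x)) 0.
  rewrite big1 => [|j _].
    exact: mulr_ge0 (mulr_ge0 D_ge0 (powR_ge0 _ _)) (powR_ge0 _ _).
  by rewrite /fs (fun_if (@normc R)) fx0 (@normc0 R) if_same expr0n mulr0.
have a0 : 0 < normc (f x) by rewrite lt_neqAle eq_sym fx0 normc_ge0.
set a := normc (f x) in fx0 a0 *.
have -> : \sum_(j < J) (t * 2 ^+ j.+1) `^ al * normc (fs (t * 2 ^+ j) x) ^+ 2 =
    (\sum_(j < J | t * 2 ^+ j <= 2 * N / a `^ (p - 1)) (t * 2 ^+ j.+1) `^ al) * a ^+ 2.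
  rewrite [in RHS]big_mkcond mulr_suml; apply: eq_bigr => j _.
  rewrite ler_pdivlMr ?powR_gt0// /fs /small -/a (fun_if (@normc R)) (@normc0 R).
  by case: ifP => _; rewrite ?expr0n ?mulr0 ?mul0r.
apply: le_trans (ler_wpM2r (sqr_ge0 _) (dyadic_sum_le _ _ al_gt0 t0)) _.
rewrite -[leLHS]mulrA -[leRHS]mulrA powR_level// ?mulr_ge0 ?(ltW N0)//.
Qed.

(** Marcinkiewicz interpolation between L^1 to l^oo and L^2 to l^2.  The power
    [q - 1] of [N] is that of an L^p to l^q bound, because the L^p norm is
    [N `^ p^-1] and [q / p = q - 1]. *)
Lemma marcinkiewicz A : [set` A] `<=` I ->
  \sum_(xi <- A) normc (fourier Omega w f xi) `^ q * W xi `^ (2 - q) <=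
    4 * B * D * 2 `^ al * N `^ (q - 1).
Proof.
move=> AI; set s := fourier Omega w f.
have [t t0 [J tJ]] := @layer_cake_le R _ (enum_fset A)
  (fun xi => normc (s xi) / W xi) (fun xi => W xi ^+ 2) al al_gt0
  (fun xi => divr_ge0 (normc_ge0 _) (W_ge0 xi)) (fun xi => sqr_ge0 _).
have -> : \sum_(xi <- A) normc (s xi) `^ q * W xi `^ (2 - q) =
    \sum_(xi <- A) (normc (s xi) / W xi) `^ (al + 2) * W xi ^+ 2.
  apply: eq_big_seq => xi xiA; have Wxi := W_gt0 (AI _ xiA).
  by rewrite /al subrK powR_weight ?normc_ge0.
apply: (le_trans tJ); rewrite -lee_fin.
have mfs2 u : measurable_fun Omega (fun x => (normc (fs u x) ^+ 2)%:E).
  by apply/measurable_EFinP/measurable_funX; exact: measurable_normc (mfs u).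
apply: (@le_trans _ _ ((4 * B)%:E * \int[mu]_(x in Omega)
    \sum_(j < J) ((t * 2 ^+ j.+1) `^ al)%:E * (normc (fs (t * 2 ^+ j) x) ^+ 2)%:E)%E).
  rewrite ge0_integral_sum//; last 2 first.
  - by move=> j; apply: measurable_funeM.
  - by move=> j x _; rewrite -EFinM lee_fin mulr_ge0 ?powR_ge0 ?sqr_ge0.
  rewrite -sumEFin ge0_sume_distrr; last first.
    move=> j _; apply: integral_ge0 => x _.
    by rewrite -EFinM lee_fin mulr_ge0 ?powR_ge0 ?sqr_ge0.
  apply: lee_sum => j _; rewrite ge0_integralZl_EFin ?powR_ge0//; last first.
    by move=> x _; rewrite lee_fin sqr_ge0.
  rewrite -moment2E muleCA EFinM lee_wpmul2l ?lee_fin ?powR_ge0//.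
  apply: le_trans (weak_type_le _ AI); last by rewrite mulr_gt0 ?exprn_gt0.
  rewrite lee_fin le_eqVlt; apply/orP; left; apply/eqP.
  rewrite big_seq_cond [RHS]big_seq_cond; apply: eq_bigr => xi /andP[xiA _].
  by rewrite -exprMn mulfVK ?gt_eqF// W_gt0//; exact: AI.
apply: (@le_trans _ _ ((4 * B)%:E * ((D * (2 * N) `^ al)%:E * moment p f))%E).
  rewrite lee_wpmul2l ?lee_fin ?mulr_ge0 ?(ltW B_gt0)//.
  rewrite -ge0_integralZl_EFin//; last 3 first.
  - by move=> x _; rewrite lee_fin powR_ge0.
  - by apply/measurable_EFinP; exact: measurable_normc_powR.
  - exact: mulr_ge0 D_ge0 (powR_ge0 _ _).
  apply: ge0_le_integral => //.
  - move=> x _; apply: sume_ge0 => j _.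
    by rewrite -EFinM lee_fin mulr_ge0 ?powR_ge0 ?sqr_ge0.
  - by apply: emeasurable_sum => j; apply: measurable_funeM.
  - apply: measurable_funeM.
    by apply/measurable_EFinP; exact: measurable_normc_powR.
  - move=> x _; under eq_bigr do rewrite -EFinM.
    by rewrite sumEFin lee_fin pointwise.
apply: (le_trans (lee_wpmul2l _ (lee_wpmul2l _ fN))).
- by rewrite lee_fin mulr_ge0 ?(ltW B_gt0).
- by rewrite lee_fin; exact: mulr_ge0 D_ge0 (powR_ge0 _ _).
have -> : N `^ (q - 1) = N * N `^ al.
  rewrite -(@mulr_powRB1 _ _ (q - 1)) ?(ltW N0)//.
    by rewrite /al; congr (_ * _ `^ _); ring.
  by have := al_gt0; rewrite /al; lra.
rewrite -!EFinM lee_fin powRM ?(ltW N0)// le_eqVlt; apply/orP; left; apply/eqP.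
by move: D (2 `^ al) (N `^ al) => d x y; ring.
Qed.

End marcinkiewicz.
End bessel_families.
(** * The coefficients of L^p functions *)

Section esum_fset.
Context {R : realType} {T : choiceType} (I : set T).
Implicit Types (a : T -> R) (A : {fset T}).

Lemma esum_le_fset a (x : \bar R) :
  (forall A, [set` A] `<=` I -> ((\sum_(i <- A) a i)%:E <= x)%E) ->
  (\esum_(i in I) (a i)%:E <= x)%E.
Proof.
move=> ax; apply: ge_ereal_sup => _ [A [finA AI] <-].
rewrite fsbig_finite// sumEFin; apply: ax.
by rewrite fset_setK.
Qed.

Lemma fset_le_esum a A : [set` A] `<=` I ->
  ((\sum_(i <- A) a i)%:E <= \esum_(i in I) (a i)%:E)%E.
Proof.
move=> AI; apply: ereal_sup_ubound; exists [set` A] => //.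
by rewrite fsbig_finite// set_fsetK sumEFin.
Qed.

End esum_fset.

Section hausdorff_young_finite.
Context {R : realType} {n : nat} (Omega : set 'rV[R]_n).
Hypothesis mOmega : measurable Omega.
Hypothesis finOmega : (lebesgue_rV n Omega < +oo)%E.
Context {K : nat} (I : set 'rV[int]_K).
Local Notation Rn := 'rV[R]_n.
Local Notation ZK := 'rV[int]_K.
Local Notation C := R[i].
Local Notation mu := (@lebesgue_rV R n).
Local Notation cmeas := (cmeasurable_fun Omega).
Local Notation moment := (moment Omega).

Variables (w : ZK -> Rn -> C).
Local Notation W := (supN Omega w).
Variables (B : R).
Hypothesis mw : forall xi, I xi -> cmeas (w xi).
Hypothesis w2 : forall xi, I xi -> (moment 2 (w xi) < +oo)%E.
Hypothesis wy : forall xi, I xi -> (LpN Omega +oo (w xi) < +oo)%E.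
Hypothesis W_gt0 : forall xi, I xi -> 0 < W xi.
Hypothesis B_gt0 : 0 < B.
Hypothesis w_upper : forall (A : {fset ZK}) c, [set` A] `<=` I ->
  (moment 2 (lincomb A c w) <= (B * \sum_(xi <- A) normc (c xi) ^+ 2)%:E)%E.

Lemma supN_ge0 xi : 0 <= W xi.
Proof. by apply: fine_ge0; exact: Lnorm_ge0. Qed.

Lemma supN_ae xi : I xi -> \forall x \ae mu, Omega x -> normc (w xi x) <= W xi.
Proof. by move=> Ixi; exact: LpNy_ae (wy Ixi). Qed.

(** For [p = 2] this is Bessel's inequality, where the constant of
    [marcinkiewicz] degenerates. *)
Lemma fourier_fset_le p : 1 < p -> p <= 2 ->
  exists2 D : R, 0 < D & forall f (A : {fset ZK}), cmeas f ->
    (moment p f < +oo)%E -> [set` A] `<=` I ->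
    \sum_(xi <- A) normc (fourier Omega w f xi) `^ (p / (p - 1)) *
      W xi `^ (2 - p / (p - 1)) <=
    D * fine (moment p f) `^ (p / (p - 1) - 1).
Proof.
move=> p1 p2; set q := p / (p - 1).
have pB : 0 < p - 1 by rewrite subr_gt0.
have qB : 0 < q - 1.
  by rewrite (_ : q - 1 = (p - 1)^-1) ?invr_gt0// /q; field; rewrite gt_eqF.
suff [D D0 HD] : exists2 D : R, 0 < D & forall f (A : {fset ZK}) N, cmeas f ->
    0 < N -> (moment p f <= N%:E)%E -> [set` A] `<=` I ->
    \sum_(xi <- A) normc (fourier Omega w f xi) `^ q * W xi `^ (2 - q) <=
    D * N `^ (q - 1).
  exists D => // f A mf foo AI; set S := (leLHS).
  have ME := moment_fineK foo.
  set M := fine (moment p f) in ME *.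
  have M0 : 0 <= M by apply: fine_ge0; exact: moment_ge0.
  have [M0'|] := ltP 0 M; first by apply: HD => //; rewrite ME.
  move=> M0'; have {M0 M0'}M0 : M = 0 by apply/eqP; rewrite eq_le M0 M0'.
  (* A vanishing moment is approached by small positive bounds on it. *)
  rewrite M0 powR0 ?gt_eqF// mulr0 leNgt; apply/negP => S0.
  have := HD f A ((S / 2 / D) `^ (q - 1)^-1) mf.
  rewrite powR_gt0 ?divr_gt0// => /(_ isT).
  rewrite -ME M0 lee_fin powR_ge0 => /(_ isT AI).
  rewrite -powRrM mulVf ?gt_eqF// powRr1 ?divr_ge0 ?(ltW S0) ?(ltW D0)//.
  by rewrite mulrC divfK ?gt_eqF// -/S; lra.
have [p2'|p2'] := eqVneq p 2.
  have q2 : q = 2 by rewrite /q p2'; field.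
  exists B => // f A N mf N0 fN AI.
  rewrite q2 p2' in fN *; rewrite (_ : 2 - 1 = 1); last by ring.
  rewrite powRr1 ?(ltW N0)// -lee_fin EFinM.
  apply: le_trans (lee_wpmul2l _ fN); last by rewrite lee_fin ltW.
  have f2 : (moment 2 f < +oo)%E by rewrite (le_lt_trans fN)// ltry.
  apply: le_trans (bessel_le mOmega mw w2 B_gt0 w_upper AI mf f2).
  rewrite lee_fin ler_sum// => xi _.
  by rewrite subrr powRr0 mulr1 powR_mulrn ?normc_ge0.
have {}p2 : p < 2 by rewrite lt_neqAle p2' p2.
exists (4 * B * ((2 `^ (q - 2)) ^+ 2 / (2 `^ (q - 2) - 1)) * 2 `^ (q - 2)).
  have q2 : 0 < q - 2 by rewrite subr_gt0 ltr_pdivlMr//; lra.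
  rewrite !mulr_gt0 ?powR_gt0 ?exprn_gt0 ?powR_gt0// invr_gt0 subr_gt0.
  exact: powR2_gt1.
move=> f A N mf N0 fN AI.
exact: (marcinkiewicz mOmega finOmega mw w2 supN_ge0 W_gt0 supN_ae B_gt0 w_upper).
Qed.

End hausdorff_young_finite.
Lemma conjugate_cases (R : realType) (p : R) (p' : \bar R) :
  1 <= p -> (p%:E^-1 + p'^-1 = 1)%E ->
  p = 1 /\ p' = +oo%E \/ 1 < p /\ p' = (p / (p - 1))%:E.
Proof.
move=> p1; have p0 : p != 0 by rewrite gt_eqF// (lt_le_trans ltr01).
rewrite inver (negbTE p0); case: (inveP p') => [|||r r0] //.
- rewrite adde0 => /eqP; rewrite eqe invr_eq1 => /eqP ->.
  by left.
- rewrite -EFinD => /eqP; rewrite eqe => /eqP pr; right.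
  have rE : r^-1 = (p - 1) / p by apply: (addrI p^-1); rewrite pr; field.
  have {}rE : r = p / (p - 1) by rewrite -[LHS]invrK rE invf_div.
  have pn1 : p != 1.
    by apply: contra_neq r0 => p1'; rewrite rE p1' subrr invr0 mulr0.
  by rewrite lt_neqAle eq_sym pn1 p1 rE.
Qed.

Section hausdorff_young_fourier.
Context {R : realType} {n : nat} (Omega : set 'rV[R]_n).
Hypothesis mOmega : measurable Omega.
Hypothesis finOmega : (lebesgue_rV n Omega < +oo)%E.
Context {K : nat} (I : set 'rV[int]_K).
Local Notation Rn := 'rV[R]_n.
Local Notation ZK := 'rV[int]_K.
Local Notation C := R[i].
Local Notation mu := (@lebesgue_rV R n).
Local Notation cmeas := (cmeasurable_fun Omega).
Local Notation moment := (moment Omega).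

Variables (w : ZK -> Rn -> C).
Local Notation W := (supN Omega w).
Variables (B : R).
Hypothesis mw : forall xi, I xi -> cmeas (w xi).
Hypothesis w2 : forall xi, I xi -> (moment 2 (w xi) < +oo)%E.
Hypothesis wy : forall xi, I xi -> (LpN Omega +oo (w xi) < +oo)%E.
Hypothesis W_gt0 : forall xi, I xi -> 0 < W xi.
Hypothesis B_gt0 : 0 < B.
Hypothesis w_upper : forall (A : {fset ZK}) c, [set` A] `<=` I ->
  (moment 2 (lincomb A c w) <= (B * \sum_(xi <- A) normc (c xi) ^+ 2)%:E)%E.

(** For an exponent [r >= 2] both branches of the weight in [lpN] agree,
    because at [r = 2] the weight is raised to the power 0. *)
Lemma lpN_ge2 (u : ZK -> Rn -> C) (r : R) (a : ZK -> C) : 2 <= r ->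
  lpN Omega I u w r%:E a =
  ((\esum_(xi in I) (normc (a xi) `^ r * W xi `^ (2 - r))%:E) `^ r^-1)%E.
Proof.
move=> r2; rewrite /lpN; case: ifPn => [r2'|_]; last by [].
have -> : r = 2 by apply/eqP; rewrite eq_le r2' r2.
by congr (_ `^ _)%E; apply: eq_esum => xi _; rewrite subrr (powRr0 (supN Omega u xi)) (powRr0 (W xi)).
Qed.

Lemma fourier_lpN_le (u : ZK -> Rn -> C) (p : R) (p' : \bar R) :
  1 <= p -> p <= 2 -> (p%:E^-1 + p'^-1 = 1)%E ->
  exists2 D : R, 1 <= D & forall f, memLp Omega p%:E f ->
    (lpN Omega I u w p' (fourier Omega w f) <= D%:E * LpN Omega p%:E f)%E.
Proof.
move=> p1 p2 /(conjugate_cases p1)[[-> ->]|[{}p1 ->]].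
  exists 1 => // f [mf _]; rewrite mul1e LpN_moment// invr1 poweRe1 ?moment_ge0//.
  apply: ge_ereal_sup => _ [xi Ixi <-].
  have fW := normc_fourier_le mOmega mw (supN_ge0 Omega w) (supN_ae wy) Ixi mf.
  rewrite EFinM muleC; have WV : (0 <= ((W xi)^-1)%:E)%E.
    by rewrite lee_fin invr_ge0 supN_ge0.
  apply: (le_trans (lee_wpmul2l WV fW)).
  by rewrite muleA -EFinM mulVf ?gt_eqF ?W_gt0// mul1e.
have [D D0 HD] := fourier_fset_le mOmega finOmega mw w2 wy W_gt0 B_gt0 w_upper p1 p2.
set q := p / (p - 1) in HD *.
have pB : 0 < p - 1 by rewrite subr_gt0.
have p0 : 0 < p by rewrite (lt_trans _ p1).
have q0 : 0 < q by rewrite divr_gt0.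
have q2 : 2 <= q by rewrite ler_pdivlMr//; lra.
exists (Num.max 1 (D `^ q^-1)); first by rewrite le_max lexx.
move=> f /(memLp_moment _ _ p0)[mf foo].
rewrite lpN_ge2// LpN_moment//.
have ME := moment_fineK foo.
apply: (@le_trans _ _ ((D * fine (moment p f) `^ (q - 1))%:E `^ q^-1)%E).
  apply: gt0_ler_poweR; rewrite ?invr_ge0 ?(ltW q0)//.
  - rewrite in_itv/= leey andbT; apply: esum_ge0 => xi _.
    by rewrite lee_fin mulr_ge0 ?powR_ge0.
  - by rewrite in_itv/= leey andbT lee_fin mulr_ge0 ?powR_ge0 ?(ltW D0).
  - by apply: esum_le_fset => A AI; rewrite lee_fin; exact: HD.
have -> : (moment p f `^ p^-1 = (fine (moment p f) `^ p^-1)%:E)%E.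
  by rewrite -[in LHS]ME poweR_EFin.
rewrite poweR_EFin -EFinM lee_fin powRM ?powR_ge0 ?(ltW D0)// -powRrM.
have -> : (q - 1) / q = p^-1.
  by rewrite /q; field; rewrite !gt_eqF.
by rewrite ler_wpM2r ?powR_ge0// le_max lexx orbT.
Qed.

End hausdorff_young_fourier.
(** * The Riesz-Fischer theorem *)

Section l2_completeness.
Context {R : realType} {n : nat} (Omega : set 'rV[R]_n).
Hypothesis mOmega : measurable Omega.
Hypothesis finOmega : (lebesgue_rV n Omega < +oo)%E.
Local Notation Rn := 'rV[R]_n.
Local Notation C := R[i].
Local Notation mu := (@lebesgue_rV R n).
Local Notation cmeas := (cmeasurable_fun Omega).
Local Notation moment := (moment Omega).

Lemma cvg_of_summable_increments (s b : R^nat) (M : R) :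
  (forall k, `|s k.+1 - s k| <= b k) ->
  (forall k, \sum_(0 <= j < k) b j <= M) -> cvgn s.
Proof.
move=> sb bM; have b0 k : 0 <= b k by apply: le_trans (sb k).
have cb : cvgn (series b).
  apply: nondecreasing_is_cvgn; first exact: nondecreasing_series.
  by exists M => _ [k _ <-]; exact: bM.
have ct : cvgn (series (telescope s)).
  apply: normed_cvg; apply: (series_le_cvg _ b0 _ cb) => k; first exact: normr_ge0.
  exact: sb.
rewrite (_ : s = fun k => s 0%N + series (telescope s) k); last first.
  by apply/funext => k; exact: eq_sum_telescope.
exact: is_cvgD (is_cvg_cst _) ct.
Qed.

Lemma cvg_fine_limn_esup (s : R^nat) : cvgn s ->
  s @ \oo --> fine (limn_esup (EFin \o s)).
Proof.
move=> cs; have cE : (EFin \o s) @ \oo --> (limn s)%:E.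
  by apply: cvg_EFin; [exact: nearW|exact: cs].
by rewrite (cvg_limn_einf_sup cE).2; exact: cs.
Qed.

Lemma limn_einf_le (s : (\bar R)^nat) (x : \bar R) :
  (forall k, (s k <= x)%E) -> (limn_einf s <= x)%E.
Proof.
move=> sx; rewrite limn_einf_lim; apply: lime_le; first exact: is_cvg_einfs.
by apply: nearW => k; apply: le_trans (sx k); apply: ereal_inf_lbound; exists k => /=.
Qed.

(** A triangle inequality with a lossy constant; it suffices because all bounds
    tend to 0. *)
Lemma moment2_triangle f g : cmeas f -> cmeas g ->
  (moment 2 (fun x => f x + g x)%R <= 2%:E * moment 2 f + 2%:E * moment 2 g)%E.
Proof.
move=> mf mg; rewrite !moment2E.
have m2 k : cmeas k ->
    measurable_fun Omega (fun x => (normc (k x) ^+ 2)%:E).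
  by move=> mk; apply/measurable_EFinP/measurable_funX; exact: measurable_normc.
have nn k (x : Rn) : Omega x -> (0 <= (normc (k x : C) ^+ 2)%:E)%E.
  by move=> _; rewrite lee_fin sqr_ge0.
rewrite -!(ge0_integralZl_EFin mu mOmega (nn _) (m2 _ _))//.
rewrite -ge0_integralD//; last 4 first.
- by move=> x Ox; rewrite mule_ge0 ?nn.
- by apply: measurable_funeM; exact: m2.
- by move=> x Ox; rewrite mule_ge0 ?nn.
- by apply: measurable_funeM; exact: m2.
apply: ge0_le_integral => //.
- exact: nn.
- exact: m2 (cmeasurableD mf mg).
- by apply: emeasurable_funD; apply: measurable_funeM; exact: m2.
move=> x _; rewrite -!EFinM -EFinD lee_fin.
have := ler_normcD (f x) (g x); have := normc_ge0 (f x + g x).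
set a := normc (f x); set b := normc (g x); set c := normc (_ + _) => c0 cab.
have : c ^+ 2 <= (a + b) ^+ 2 by rewrite ler_sqr ?nnegrE// (le_trans c0 cab).
by have := sqr_ge0 (a - b); nra.
Qed.

(** Increments bounded by [2 ^- k] in L^2 are bounded by a multiple of it in
    L^1, as the measure is finite, hence summable almost everywhere; the L^2
    bound passes to the pointwise limit by Fatou's lemma. *)
Lemma L2_limit_of_rapid_cauchy (G : nat -> Rn -> C) (c : R) : 0 <= c ->
  (forall k, cmeas (G k)) ->
  (forall k j, (k <= j)%N ->
    (moment 2 (fun x => G j x - G k x)%R <= (c / (2 ^ k)%:R ^+ 2)%:E)%E) ->
  exists2 g, cmeas g & forall k,
    (moment 2 (fun x => g x - G k x)%R <= (c / (2 ^ k)%:R ^+ 2)%:E)%E.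
Proof.
move=> c0 mG cauchyG.
have mB k j : cmeas (fun x => G j x - G k x) by exact: cmeasurableB.
pose m1 := c + fine (mu Omega).
have m10 : 0 <= m1 by rewrite addr_ge0// fine_ge0.
have inc k : (moment 1 (fun x => G k.+1 x - G k x)%R <= (m1 / (2 ^ k.+1)%:R)%:E)%E.
  have t0 : 0 < (2 ^ k)%:R :> R by rewrite ltr0n expn_gt0.
  have := moment1_mul_conj_le mOmega t0 (mB k k.+1) (cmeasurable_cst Omega 1).
  have -> : (fun x => (G k.+1 x - G k x) * conjc 1) = (fun x => G k.+1 x - G k x).
    by apply/funext => x; rewrite conjc1 mulr1.
  move=> /le_trans; apply.
  apply: (le_trans (leeD2r _ (lee_wpmul2l _ (cauchyG k k.+1 (leqnSn k))))).
    by rewrite lee_fin divr_ge0 ?(ltW t0).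
  rewrite moment2E; under eq_integral do rewrite (@normc1 R) expr1n.
  have -> : (\int[mu]_(x in Omega) 1 = (fine (mu Omega))%:E)%E.
    by rewrite integral_cst// mul1e fineK ?ge0_fin_numE.
  rewrite -!EFinM -EFinD lee_fin /m1 expnS natrM.
  move: (2 ^ k)%:R t0 (fine _) => t t0 y.
  by rewrite le_eqVlt; apply/orP; left; apply/eqP; field; rewrite gt_eqF.
pose S x := (\sum_(0 <= k <oo) (normc (G k.+1 x - G k x))%:E)%E.
have Sfin : \forall x \ae mu, Omega x -> S x \is a fin_num.
  apply: integrable_ae => //; apply/integrableP; split.
    apply: ge0_emeasurable_sum => //.
    - by move=> k x _ _; rewrite lee_fin normc_ge0.
    - by move=> k _; apply/measurable_EFinP; exact: measurable_normc (mB k k.+1).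
  under eq_integral => x _.
    rewrite gee0_abs; first over.
    by apply: nneseries_ge0 => k _ _; rewrite lee_fin normc_ge0.
  rewrite integral_nneseries//; last 2 first.
  - by move=> k; apply/measurable_EFinP; exact: measurable_normc (mB k k.+1).
  - by move=> k x _; rewrite lee_fin normc_ge0.
  apply: (@le_lt_trans _ _ m1%:E); last exact: ltry.
  apply: le_trans (epsilon_trick0 xpredT m10).
  apply: lee_nneseries => k _; first by move=> _; apply: integral_ge0 => x _; rewrite lee_fin normc_ge0.
  by rewrite -moment1E; exact: inc.
have cvgG : \forall x \ae mu, Omega x ->
    cvgn (fun k => complex.Re (G k x)) /\ cvgn (fun k => complex.Im (G k x)).
  apply: filterS Sfin => x /[apply] Sx.
  have sumS k : \sum_(0 <= j < k) normc (G j.+1 x - G j x) <= fine (S x).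
    rewrite -lee_fin fineK// -sumEFin; apply: nneseries_lim_ge => j _ _.
    by rewrite lee_fin normc_ge0.
  split; apply: cvg_of_summable_increments sumS => k.
    by rewrite -Re_opp -Re_add normc_Re.
  by rewrite -Im_opp -Im_add normc_Im.
pose g x : C := Complex (fine (limn_esup (fun k => (complex.Re (G k x))%:E)))
                        (fine (limn_esup (fun k => (complex.Im (G k x))%:E))).
have mg : cmeas g.
  split; apply: (measurableT_comp (fine_measurable _)) => //;
    apply: measurable_fun_limn_esup => k; apply/measurable_EFinP; by case: (mG k).
exists g => // k.
have lim_sq : \forall x \ae mu, Omega x -> (normc (g x - G k x) ^+ 2)%:E =
    limn_einf (fun j => (normc (G (k + j)%N x - G k x) ^+ 2)%:E).
  apply: filterS cvgG => x /[apply] -[/cvg_fine_limn_esup cRe /cvg_fine_limn_esup cIm].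
  apply/esym; apply: (cvg_limn_einf_sup _).1; apply: cvg_EFin; first exact: nearW.
  rewrite sqr_normcE Re_add Re_opp Im_add Im_opp.
  rewrite [X in X @ _ --> _](_ : _ = fun j =>
      (complex.Re (G (k + j)%N x) - complex.Re (G k x)) ^+ 2 +
      (complex.Im (G (k + j)%N x) - complex.Im (G k x)) ^+ 2); last first.
    by apply/funext => j /=; rewrite sqr_normcE Re_add Re_opp Im_add Im_opp.
  apply: cvgD.
    rewrite !expr2; under eq_fun do rewrite expr2.
    by apply: cvgM; apply: cvgB; [|exact: cvg_cst| |exact: cvg_cst];
      apply: (cvg_comp _ _ (cvg_addnl k) cRe).
  rewrite !expr2; under eq_fun do rewrite expr2.
  by apply: cvgM; apply: cvgB; [|exact: cvg_cst| |exact: cvg_cst];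
    apply: (cvg_comp _ _ (cvg_addnl k) cIm).
have msq j : measurable_fun Omega (fun x => (normc (G (k + j)%N x - G k x) ^+ 2)%:E).
  by apply/measurable_EFinP/measurable_funX; exact: measurable_normc (mB _ _).
rewrite moment2E (ge0_ae_eq_integral _ _ _ _ _ lim_sq)//; last 4 first.
- apply/measurable_EFinP/measurable_funX.
  exact: measurable_normc (cmeasurableB mg (mG k)).
- rewrite (_ : (fun _ => _) = (fun x =>
      - limn_esup (fun j => - (normc (G (k + j)%N x - G k x) ^+ 2)%:E))%E); last first.
    apply/funext => x; rewrite -limn_einfN; congr limn_einf.
    by apply/funext => j; apply/esym; exact: oppeK.
  apply: measurableT_comp => //; apply: measurable_fun_limn_esup => j.
  exact: measurableT_comp.
- by move=> x _; rewrite lee_fin sqr_ge0.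
- move=> x _; rewrite limn_einf_lim; apply: lime_ge; first exact: is_cvg_einfs.
  by apply: nearW => j; apply: le_ereal_inf_tmp => _ [i _ <-]; rewrite lee_fin sqr_ge0.
apply: le_trans; first by apply: (fatou mu mOmega msq) => j x _; rewrite lee_fin sqr_ge0.
apply: limn_einf_le => j; rewrite -moment2E.
by apply: cauchyG; exact: leq_addr.
Qed.

End l2_completeness.
Section fset_sums.
Context {T : choiceType}.
Local Open Scope fset_scope.

Lemma big_fset_setD (V : nmodType) (A A' : {fset T}) (F : T -> V) : A `<=` A' ->
  (\sum_(i <- A') F i = \sum_(i <- A) F i + \sum_(i <- A' `\` A) F i)%R.
Proof.
move=> AA'; rewrite (big_fsetID _ (mem A)) /=; congr (_ + _)%R.
  apply: eq_fbigl => x; rewrite !inE /=.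
  by apply/andP/idP => [[]//|xA]; rewrite (fsubsetP AA').
by apply: eq_fbigl => x; rewrite !inE /= andbC.
Qed.

(** Replaces the net of all finite subsets of [I] by a sequence of them, so that
    completeness for sequences applies to unconditional sums. *)
Lemma fset_exhaustion (R : realType) (I : set T) (b : T -> R) (M : R) (e : nat -> R) :
  (forall i, 0 <= b i)%R -> (forall k, 0 < e k)%R ->
  (forall A : {fset T}, [set` A] `<=` I -> \sum_(i <- A) b i <= M)%classic%R ->
  exists A : nat -> {fset T},
  [/\ forall k, ([set` A k] `<=` I)%classic,
      forall k j, (k <= j)%N -> A k `<=` A j &
      forall k A', A k `<=` A' -> ([set` A'] `<=` I)%classic ->
        (\sum_(i <- A' `\` A k) b i <= e k)%R].
Proof.
move=> b0 e0 bM.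
pose S := [set (\sum_(i <- A) b i)%R | A in [set A : {fset T} | ([set` A] `<=` I)%classic]].
have supS : has_sup S.
  split; last by exists M => _ [A AI <-]; exact: bM.
  by exists (\sum_(i <- fset0) b i)%R; exists fset0.
have /(_ _)/cid-/all_sig[A0 A0P] (k : nat) : exists A : {fset T},
    ([set` A] `<=` I)%classic /\ (sup S - e k < \sum_(i <- A) b i)%R.
  by have [_ [A AI <-] ?] := sup_adherent (e0 k) supS; exists A.
pose A k := \bigcup_(j <- iota 0 k.+1) A0 j.
have AI k : ([set` A k] `<=` I)%classic.
  by move=> x /= /bigfcupP[j _ xj]; exact: (A0P j).1.
exists A; split => // [k j kj|k A' AA' A'I].
  apply/bigfcupsP => i; rewrite mem_iota => ik _.
  by apply: bigfcup_sup => //; rewrite mem_iota; move: ik; rewrite !add0n !ltnS => /leq_trans; apply.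
have A0A : A0 k `<=` A k by apply: bigfcup_sup => //; rewrite mem_iota/= add0n ltnSn.
have := sup_upper_bound supS (x := (\sum_(i <- A') b i)%R) _.
move=> /(_ (ex_intro2 _ _ A' A'I erefl)).
have := (A0P k).2; rewrite (big_fset_setD _ AA') (big_fset_setD _ A0A).
have : (0 <= \sum_(i <- A k `\` A0 k) b i)%R by apply: sumr_ge0.
lra.
Qed.

End fset_sums.

Section riesz_fischer.
Context {R : realType} {n : nat} (Omega : set 'rV[R]_n).
Hypothesis mOmega : measurable Omega.
Hypothesis finOmega : (lebesgue_rV n Omega < +oo)%E.
Context {K : nat} (I : set 'rV[int]_K).
Local Notation Rn := 'rV[R]_n.
Local Notation ZK := 'rV[int]_K.
Local Notation C := R[i].
Local Notation cmeas := (cmeasurable_fun Omega).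
Local Notation moment := (moment Omega).

Variables (u : ZK -> Rn -> C) (B : R).
Hypothesis mu_ : forall xi, I xi -> cmeas (u xi).
Hypothesis B_gt0 : 0 < B.
Hypothesis u_upper : forall (A : {fset ZK}) c, [set` A] `<=` I ->
  (moment 2 (lincomb A c u) <= (B * \sum_(xi <- A) normc (c xi) ^+ 2)%:E)%E.

Lemma moment2_lt_LpN (e : R) f : 0 < e -> (moment 2 f < (e ^+ 2)%:E)%E ->
  (LpN Omega 2%:E f < e%:E)%E.
Proof.
move=> e0; rewrite -(@poweR_LpN _ _ Omega 2)// !ltNge; apply: contra => ef.
rewrite -(powR_mulrn _ (ltW e0)) -poweR_EFin.
apply: gt0_ler_poweR => //; rewrite in_itv/= leey andbT ?lee_fin ?(ltW e0)//.
exact: Lnorm_ge0.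
Qed.

Lemma LpN_le_moment2 (e : R) f : 0 <= e -> (LpN Omega 2%:E f <= e%:E)%E ->
  (moment 2 f <= (e ^+ 2)%:E)%E.
Proof.
move=> e0 fe; rewrite -(@poweR_LpN _ _ Omega 2)//.
rewrite -(powR_mulrn _ e0) -poweR_EFin.
apply: gt0_ler_poweR => //; rewrite in_itv/= leey andbT ?lee_fin//.
exact: Lnorm_ge0.
Qed.

(** Along an exhaustion whose tails have coefficient sum at most [4 ^- k] the
    finite sections are rapidly Cauchy in L^2, and every larger finite section is
    as close to the limit as the one it contains. *)
Lemma inverse_fourier_exists (a : ZK -> C) (M : R) :
  (forall A : {fset ZK}, [set` A] `<=` I ->
    \sum_(xi <- A) normc (a xi) ^+ 2 <= M) ->
  exists g, inverse_fourier Omega I u a g.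
Proof.
move=> aM; pose e k : R := ((2 ^ k)%:R ^+ 2)^-1.
have e0 k : 0 < e k by rewrite invr_gt0 exprn_gt0// ltr0n expn_gt0.
have [A [AI Amono Atail]] := fset_exhaustion (fun xi => sqr_ge0 (normc (a xi))) e0 aM.
have tail k A' : (A k `<=` A')%fset -> [set` A'] `<=` I ->
    (moment 2 (fun x => lincomb A' a u x - lincomb (A k) a u x)%R <= (B * e k)%:E)%E.
  move=> AA' A'I; rewrite (_ : (fun x => _) = lincomb (A' `\` A k)%fset a u).
    have DI : [set` (A' `\` A k)%fset] `<=` I.
      by move=> xi /=; rewrite inE => /andP[_]; exact: A'I.
    apply: (le_trans (u_upper a DI)); rewrite lee_fin ler_wpM2l ?(ltW B_gt0)//.
    exact: Atail.
  by apply/funext => x; rewrite /lincomb (big_fset_setD _ AA') addrC addKr.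
have mA (A' : {fset ZK}) : [set` A'] `<=` I -> cmeas (lincomb A' a u).
  by move=> A'I; exact: (cmeasurable_lincomb mu_ a A'I).
have [g mg gA] := L2_limit_of_rapid_cauchy mOmega finOmega (ltW B_gt0)
  (fun k => mA _ (AI k)) (fun k j kj => tail k _ (Amono _ _ kj) (AI j)).
exists g; split.
  apply/(memLp_moment _ _ (ltr0Sn R 1)); split=> //.
  have := moment2_triangle mOmega (cmeasurableB mg (mA _ (AI 0%N))) (mA _ (AI 0%N)).
  under [X in (moment 2 X <= _)%E -> _]eq_fun do rewrite subrK.
  move=> /le_lt_trans; apply.
  apply: lte_add_pinfty; apply: lte_mul_pinfty; rewrite ?lee_fin//.
    by apply: (le_lt_trans (gA 0%N)); exact: ltry.
  by apply: (le_lt_trans (u_upper a (AI 0%N))); exact: ltry.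
move=> eps eps0.
have [k ke] : exists k, 4 * (B * e k) < eps ^+ 2.
  exists (Num.bound (4 * B / eps ^+ 2)); set k := Num.bound _.
  have t0 : 0 < (2 ^ k)%:R :> R by rewrite ltr0n expn_gt0.
  have : 4 * B / eps ^+ 2 < (2 ^ k)%:R ^+ 2.
    rewrite (@lt_le_trans _ _ (2 ^ k)%:R)//.
      by rewrite natrX; exact: upper_nthrootP.
    by rewrite ler_eXnr// ler1n expn_gt0.
  rewrite ltr_pdivrMr ?exprn_gt0// => kB.
  by rewrite /e mulrA ltr_pdivrMr ?exprn_gt0// [ltRHS]mulrC.
exists (A k); split=> // A' AA' A'I; apply: moment2_lt_LpN => //.
have := moment2_triangle mOmega (cmeasurableB mg (mA _ (AI k)))
  (cmeasurableB (mA _ (AI k)) (mA _ A'I)).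
under [X in (moment 2 X <= _)%E -> _]eq_fun do rewrite addrA subrK.
move=> /le_lt_trans; apply.
have -> : moment 2 (fun x => lincomb (A k) a u x - lincomb A' a u x) =
    moment 2 (fun x => lincomb A' a u x - lincomb (A k) a u x).
  by apply: eq_integral => x _; rewrite -normc_opp opprB.
apply: (@le_lt_trans _ _ (2%:E * (B * e k)%:E + 2%:E * (B * e k)%:E)%E).
  have two0 : (0 <= 2%:E :> \bar R)%E by rewrite lee_fin.
  exact: leeD (lee_wpmul2l two0 (gA k)) (lee_wpmul2l two0 (tail k _ AA' A'I)).
by rewrite -!EFinM -EFinD lte_fin; apply: le_lt_trans ke; lra.
Qed.

End riesz_fischer.
(** * Sums of series tested against bounded functions *)

Section duality.
Context {R : realType} {n : nat} (Omega : set 'rV[R]_n).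
Hypothesis mOmega : measurable Omega.
Hypothesis finOmega : (lebesgue_rV n Omega < +oo)%E.
Context {K : nat} (I : set 'rV[int]_K).
Local Notation Rn := 'rV[R]_n.
Local Notation ZK := 'rV[int]_K.
Local Notation C := R[i].
Local Notation mu := (@lebesgue_rV R n).
Local Notation cmeas := (cmeasurable_fun Omega).
Local Notation moment := (moment Omega).

Definition trunc (k : R) (g : Rn -> C) (x : Rn) : C :=
  if normc (g x) <= k then g x else 0.

Lemma cmeasurable_trunc k g : cmeas g -> cmeas (trunc k g).
Proof.
move=> mg; apply: (cmeasurable_if mOmega _ mg (cmeasurable_cst Omega 0)).
by apply: measurable_fun_ler; [exact: measurable_normc|exact: measurable_cst].
Qed.

Lemma normc_trunc k g x : 0 <= k -> normc (trunc k g x) <= k.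
Proof. by move=> k0; rewrite /trunc; case: ifPn => // _; rewrite (@normc0 R). Qed.

(** Truncations are bounded, so their moments are finite and may be divided by;
    the bound survives as the truncation level grows. *)
Lemma moment_trunc_le q g (y : \bar R) : cmeas g ->
  (forall k : nat, (moment q (trunc k%:R g) <= y)%E) -> (moment q g <= y)%E.
Proof.
move=> mg gy.
have -> : moment q g = (\int[mu]_(x in Omega)
    limn_einf (fun k : nat => (normc (trunc k%:R g x) `^ q)%:E))%E.
  apply: eq_integral => x _; apply/esym; apply: (cvg_limn_einf_sup _).1.
  apply: (cvg_near_cst _) => /=; exists (Num.bound (normc (g x))) => // k /= kg.
  rewrite /trunc ifT//; apply: le_trans (ltW (archi_boundP (normc_ge0 _))) _.
  by rewrite ler_nat.
apply: le_trans; first apply: (fatou mu mOmega).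
- by move=> k; apply/measurable_EFinP; exact: measurable_normc_powR (cmeasurable_trunc _ mg).
- by move=> k x _; rewrite lee_fin powR_ge0.
- exact: limn_einf_le.
Qed.

Lemma normc_cintegral_real (h : Rn -> R) : (forall x, 0 <= h x) ->
  normc (cintegral Omega (fun x => (h x)%:C%C)) = fine (\int[mu]_(x in Omega) (h x)%:E)%E.
Proof.
move=> h0; rewrite (_ : cintegral _ _ = (fine (\int[mu]_(x in Omega) (h x)%:E)%E)%:C%C).
  rewrite normc_real ger0_norm//; apply: fine_ge0; apply: integral_ge0 => x _.
  by rewrite lee_fin.
by apply: complex_eqP => //=; rewrite /Rintegral integral0.
Qed.

Lemma mul_conj_trunc k g x :
  g x * conjc (trunc k g x) = (normc (trunc k g x) ^+ 2)%:C%C.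
Proof.
rewrite /trunc; case: ifPn => _; first exact: mul_conjc.
by rewrite conjc0 mulr0 (@normc0 R) expr0n.
Qed.

Section series.
Variables (u : ZK -> Rn -> C) (a : ZK -> C) (g : Rn -> C).
Hypothesis mu_ : forall xi, I xi -> cmeas (u xi).
Hypothesis u2 : forall xi, I xi -> (moment 2 (u xi) < +oo)%E.
Hypothesis ga : inverse_fourier Omega I u a g.

Lemma cmeasurable_inverse_fourier : cmeas g.
Proof. by case: ga => -[]. Qed.

(** Pairing with a fixed square-integrable function is continuous for the L^2
    convergence of the series, so it suffices to bound its finite sections. *)
Lemma normc_inner_series_le h X : cmeas h -> (moment 2 h < +oo)%E ->
  (forall A : {fset ZK}, [set` A] `<=` I ->
    \sum_(xi <- A) normc (a xi) * normc (fourier Omega u h xi) <= X) ->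
  normc (inner Omega g h) <= X.
Proof.
move=> mh h2 hX; have mg := cmeasurable_inverse_fourier.
case: (ga) => /(memLp_moment _ _ (ltr0Sn R 1))[_ g2] cvga.
apply/ler_addgt0Pr => d d0.
(* With [t] this large the contribution of [h] is at most [d / 2]; the section
   [A] is then chosen so that the remainder contributes [d / 2] as well. *)
have HE := moment_fineK h2.
set H := fine (moment 2 h) in HE.
have H0 : 0 <= H by apply: fine_ge0; exact: moment_ge0.
pose t := (H + 1) / d; have t0 : 0 < t by rewrite divr_gt0// ltr_wpDl.
have e0 : 0 < Num.sqrt (d / t) by rewrite sqrtr_gt0 divr_gt0.
have [A [AI /(_ A (fsubset_refl A) AI) gA]] := cvga _ e0.
have {}gA := LpN_le_moment2 (sqrtr_ge0 _) (ltW gA).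
rewrite sqr_sqrtr in gA; last by rewrite divr_ge0 ?(ltW d0) ?(ltW t0).
have mA : cmeas (lincomb A a u) by exact: (cmeasurable_lincomb mu_ a AI).
have iuh xi : xi \in A -> cintegrable Omega (fun x => u xi x * conjc (h x)).
  by move=> /AI Ixi; exact: (cintegrable_mul_conj mOmega (mu_ Ixi) mh (u2 Ixi) h2).
have iAh : cintegrable Omega (fun x => lincomb A a u x * conjc (h x)).
  rewrite (_ : (fun x => _) =
      fun x => \sum_(xi <- A) a xi * (u xi x * conjc (h x))).
    by apply: (cintegrable_sum mOmega) => xi /iuh; exact: (cintegrableZ mOmega).
  apply/funext => x; rewrite mulr_suml.
  by apply: eq_bigr => xi _; rewrite mulrA.
have iDh : cintegrable Omega (fun x => (g x - lincomb A a u x) * conjc (h x)).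
  apply: (cintegrable_mul_conj mOmega (cmeasurableB mg mA) mh _ h2).
  by rewrite (le_lt_trans gA)// ltry.
have -> : inner Omega g h =
    inner Omega (fun x => g x - lincomb A a u x) h + inner Omega (lincomb A a u) h.
  rewrite /inner -(cintegralD mOmega iDh iAh).
  by apply: eq_cintegral => x _; rewrite -mulrDl subrK.
apply: (le_trans (ler_normcD _ _)); rewrite addrC lerD//.
  rewrite (inner_suml mOmega); last exact: iuh.
  apply: (le_trans (ler_normc_sum _ _)); apply: le_trans (hX A AI).
  rewrite big_seq [leRHS]big_seq ler_sum// => xi xiA.
  by rewrite normcM -(normc_innerC mOmega (iuh _ xiA)).
rewrite -lee_fin; apply: (le_trans (normc_inner_le mOmega t0 (cmeasurableB mg mA) mh)).
have t20 : (0 <= (t / 2)%:E)%E by rewrite lee_fin divr_ge0 ?(ltW t0).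
apply: (le_trans (leeD2r _ (lee_wpmul2l t20 gA))).
rewrite -HE -!EFinM -EFinD lee_fin.
have -> : t / 2 * (d / t) = d / 2 by field; rewrite gt_eqF.
have -> : t^-1 / 2 * H = d / 2 * (H / (H + 1)).
  by rewrite /t; field; rewrite !gt_eqF// ltr_wpDl.
have : H / (H + 1) <= 1 by rewrite ler_pdivrMr ?ltr_wpDl// mul1r lerDl.
by have := divr_ge0 H0 (addr_ge0 H0 ler01); nra.
Qed.

End series.
End duality.
(** * The sum of a series with l^p coefficients *)

Section hausdorff_young_inverse.
Context {R : realType} {n : nat} (Omega : set 'rV[R]_n).
Hypothesis mOmega : measurable Omega.
Hypothesis finOmega : (lebesgue_rV n Omega < +oo)%E.
Context {K : nat} (I : set 'rV[int]_K).
Local Notation Rn := 'rV[R]_n.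
Local Notation ZK := 'rV[int]_K.
Local Notation C := R[i].
Local Notation mu := (@lebesgue_rV R n).
Local Notation cmeas := (cmeasurable_fun Omega).
Local Notation moment := (moment Omega).

Variables (u : ZK -> Rn -> C).
Local Notation W := (supN Omega u).
Hypothesis mu_ : forall xi, I xi -> cmeas (u xi).
Hypothesis u2 : forall xi, I xi -> (moment 2 (u xi) < +oo)%E.
Hypothesis uy : forall xi, I xi -> (LpN Omega +oo (u xi) < +oo)%E.
Hypothesis W_gt0 : forall xi, I xi -> 0 < W xi.

(** An inequality [G <= E ^ (1 / p) * (D * G ^ (q - 1)) ^ (1 / q)], in which [G]
    occurs on both sides, can be solved for [G] because [(q - 1) / q < 1]. *)
Lemma absorb_powR (G E D p : R) : 1 < p -> 0 <= G -> 0 <= E -> 0 <= D ->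
  G <= E `^ p^-1 * (D * G `^ (p / (p - 1) - 1)) `^ (p / (p - 1))^-1 ->
  G <= D * E `^ (p / (p - 1) - 1).
Proof.
move=> p1; set q := p / (p - 1) => G0 E0 D0.
have pB : 0 < p - 1 by rewrite subr_gt0.
have p0 : 0 < p by rewrite (lt_trans _ p1).
have q0 : 0 < q by rewrite divr_gt0.
have [->|Gn0] := eqVneq G 0; first by move=> _; rewrite mulr_ge0 ?powR_ge0.
have Gp : 0 < G by rewrite lt_neqAle eq_sym Gn0.
move=> /(powR_homo_ge0 (ltW q0) G0).
have y0 : 0 <= D * G `^ (q - 1) by rewrite mulr_ge0 ?powR_ge0.
rewrite powRM ?powR_ge0// -!powRrM mulVf ?(gt_eqF q0)// powRr1//.
have -> : p^-1 * q = q - 1 by rewrite /q; field; rewrite !gt_eqF.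
rewrite -[in leLHS](@mulr_powRB1 _ G q)// mulrA ler_pM2r ?powR_gt0//.
by rewrite mulrC.
Qed.

Section bounded_series.
Variables (a : ZK -> C) (g : Rn -> C).
Hypothesis ga : inverse_fourier Omega I u a g.

(** Testing [g] against its extremal function [|g| ^ (q - 2) * g] turns the bound
    for the coefficients of L^p functions, which [D] expresses, into one for
    [g]. *)
Lemma inverse_fourier_moment_le (p E D : R) : 1 < p -> p <= 2 -> 0 <= D ->
  (forall h (A : {fset ZK}), cmeas h -> (moment p h < +oo)%E ->
    [set` A] `<=` I ->
    \sum_(xi <- A) normc (fourier Omega u h xi) `^ (p / (p - 1)) *
      W xi `^ (2 - p / (p - 1)) <=
    D * fine (moment p h) `^ (p / (p - 1) - 1)) ->
  (forall A : {fset ZK}, [set` A] `<=` I ->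
    \sum_(xi <- A) normc (a xi) `^ p * W xi `^ (2 - p) <= E) ->
  (moment (p / (p - 1)) g <= (D * E `^ (p / (p - 1) - 1))%:E)%E.
Proof.
move=> p1 p2 D0; set q := p / (p - 1) => HY aE.
have pB : 0 < p - 1 by rewrite subr_gt0.
have p0 : 0 < p by rewrite (lt_trans _ p1).
have q0 : 0 < q by rewrite divr_gt0.
have q1 : q - 1 = (p - 1)^-1 by rewrite /q; field; rewrite gt_eqF.
have qB : 0 < q - 1 by rewrite q1 invr_gt0.
have E0 : 0 <= E by have := aE fset0; rewrite big_seq_fset0; apply.
have mg := cmeasurable_inverse_fourier ga.
apply: (moment_trunc_le mOmega mg) => k.
set gk := trunc k%:R g.
have mgk : cmeas gk by exact: cmeasurable_trunc.
have gk_bounded r : 0 <= r -> (moment r gk < +oo)%E.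
  move=> r0; apply: (moment_bounded mOmega finOmega r0 mgk (k := k%:R)) => x _.
  exact: normc_trunc.
(* The extremal function of the duality between L^q and L^p. *)
pose h x : C := (normc (gk x) `^ (q - 2))%:C%C * gk x.
have normch x : normc (h x) = normc (gk x) `^ (q - 1).
  rewrite /h normcM normc_real ger0_norm ?powR_ge0// mulrC.
  rewrite -(@mulr_powRB1 _ (normc (gk x)) (q - 1)) ?normc_ge0//.
  by congr (_ * _ `^ _); ring.
have mh : cmeas h.
  apply: cmeasurableM => //; apply: cmeasurable_real; exact: measurable_normc_powR.
have hp : moment p h = moment q gk.
  apply: eq_integral => x _; rewrite normch -powRrM.
  by congr (_ `^ _)%:E; rewrite q1 /q mulrC.
set G := fine (moment q gk).
have GE : G%:E = moment q gk by apply: moment_fineK; exact: gk_bounded (ltW q0).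
have G0 : 0 <= G by apply: fine_ge0; exact: moment_ge0.
have h2 : (moment 2 h < +oo)%E.
  apply: (moment_bounded mOmega finOmega (ler0n R 2) mh (k := k%:R `^ (q - 1))) => x _.
  by rewrite normch; exact: powR_homo_ge0 (ltW qB) (normc_ge0 _) (normc_trunc g x (ler0n _ _)).
have innerE : normc (inner Omega g h) = G.
  have -> : inner Omega g h = cintegral Omega (fun x => (normc (gk x) `^ q)%:C%C).
    apply: eq_cintegral => x _; rewrite /h conjcM conjc_real mulrCA mul_conj_trunc -/gk.
    rewrite -rmorphM; congr (_%:C)%C.
    have [->|gn0] := eqVneq (normc (gk x)) 0.
      by rewrite expr0n mulr0 powR0 ?gt_eqF.
    move: (normc (gk x)) (normc_ge0 (gk x)) gn0 => y y0 yn0.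
    by rewrite -powR_mulrn// -powRD ?subrK// yn0 implybT.
  by rewrite (normc_cintegral_real _ (fun x => powR_ge0 (normc (gk x)) q)).
rewrite -GE lee_fin; apply: (absorb_powR p1 G0 E0 D0); rewrite -/q -[leLHS]innerE.
apply: (normc_inner_series_le mOmega mu_ u2 ga mh h2) => A AI.
have pq : p^-1 + q^-1 = 1 by rewrite /q; field; rewrite !gt_eqF.
have weights0 : (2 - p) / p + (2 - q) / q = 0 by rewrite /q; field; rewrite !gt_eqF.
pose al xi := normc (a xi) * W xi `^ ((2 - p) / p).
pose be xi := normc (fourier Omega u h xi) * W xi `^ ((2 - q) / q).
have -> : \sum_(xi <- A) normc (a xi) * normc (fourier Omega u h xi) =
    \sum_(xi <- A) al xi * be xi.
  apply: eq_big_seq => xi /AI Ixi; rewrite /al /be mulrACA -powRD.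
    by rewrite weights0 powRr0 mulr1.
  by rewrite (gt_eqF (W_gt0 Ixi)) implybT.
apply: (le_trans (hoelder_sum _ _ _ p0 q0 pq)).
- by move=> xi; rewrite mulr_ge0 ?normc_ge0 ?powR_ge0.
- by move=> xi; rewrite mulr_ge0 ?normc_ge0 ?powR_ge0.
apply: (ler_pM (powR_ge0 _ _) (powR_ge0 _ _)).
  apply: powR_homo_ge0; first by rewrite invr_ge0 ltW.
    by apply: sumr_ge0 => xi _; exact: powR_ge0.
  apply: le_trans (aE A AI); rewrite le_eqVlt; apply/orP; left; apply/eqP.
  by apply: eq_bigr => xi _; rewrite powR_weighted ?normc_ge0.
apply: powR_homo_ge0; first by rewrite invr_ge0 ltW.
  by apply: sumr_ge0 => xi _; exact: powR_ge0.
have : (moment p h < +oo)%E by rewrite hp gk_bounded ?ltW.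
move=> /(HY h A mh)/(_ AI); rewrite hp -/G; apply: le_trans.
rewrite le_eqVlt; apply/orP; left; apply/eqP.
by apply: eq_bigr => xi _; rewrite powR_weighted ?normc_ge0.
Qed.

(** On the set where [g] exceeds [E + d] the phase [h] of [g] satisfies
    [(E + d) * P <= |(g, h)| <= E * P], where [P] is the measure of that set. *)
Lemma inverse_fourier_sup_le (E : R) :
  (forall A : {fset ZK}, [set` A] `<=` I ->
    \sum_(xi <- A) normc (a xi) * W xi <= E) ->
  (LpN Omega +oo g <= E%:E)%E.
Proof.
move=> aE; have E0 : 0 <= E by have := aE fset0; rewrite big_seq_fset0; apply.
have mg := cmeasurable_inverse_fourier ga.
apply/lee_addgt0Pr => d d0; rewrite -EFinD.
apply: LpNy_le; first by rewrite addr_ge0// ltW.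
pose big x := ~~ (normc (g x) <= E + d).
have mbig : measurable_fun Omega big.
  apply: measurableT_comp => //; apply: measurable_fun_ler; last exact: measurable_cst.
  exact: measurable_normc.
have big0 x : big x -> 0 < normc (g x).
  by rewrite /big -ltNge; apply: le_lt_trans; rewrite addr_ge0// ltW.
pose gb x : C := if big x then g x else 0.
have mgb : cmeas gb by exact: (cmeasurable_if mOmega mbig mg (cmeasurable_cst Omega 0)).
pose h x : C := ((normc (gb x))^-1)%:C%C * gb x.
have normch x : normc (h x) = if big x then 1 else 0.
  rewrite /h /gb normcM normc_real ger0_norm ?invr_ge0 ?normc_ge0//.
  case: ifPn => [/big0 gx|_]; last by rewrite (@normc0 R) mulr0.
  by rewrite mulVf ?gt_eqF.
have mh : cmeas h.
  apply: cmeasurableM => //; apply: cmeasurable_real.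
  under eq_fun do rewrite -powR_inv1 ?normc_ge0//.
  exact: measurable_normc_powR.
have h_bounded r : 0 <= r -> (moment r h < +oo)%E.
  move=> r0; apply: (moment_bounded mOmega finOmega r0 mh (k := 1)) => x _.
  by rewrite normch; case: ifP.
have h1 := h_bounded _ ler01; have h2 := h_bounded _ (ler0n R 2).
have PE := moment_fineK h1; set P := fine (moment 1 h) in PE.
have P0 : 0 <= P by apply: fine_ge0; exact: moment_ge0.
have g1 : (moment 1 g < +oo)%E.
  case: (ga) => /(memLp_moment _ _ (ltr0Sn R 1))[_ g2] _.
  have one2 : 1 <= 2 :> R by rewrite ler1n.
  exact: (moment1_lty mOmega finOmega one2 mg g2).
have gb1 : (moment 1 gb < +oo)%E.
  apply: le_lt_trans g1; apply: (le_moment mOmega ler01 mgb mg) => x _.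
  by rewrite /gb; case: ifP => // _; rewrite (@normc0 R) normc_ge0.
have innerE : normc (inner Omega g h) = fine (moment 1 gb).
  have -> : inner Omega g h = cintegral Omega (fun x => (normc (gb x))%:C%C).
    apply: eq_cintegral => x _; rewrite /h conjcM conjc_real mulrCA.
    have -> : g x * conjc (gb x) = (normc (gb x) ^+ 2)%:C%C.
      rewrite /gb; case: ifP => _; first exact: mul_conjc.
      by rewrite conjc0 mulr0 (@normc0 R) expr0n.
    rewrite -rmorphM; congr (_%:C)%C.
    have [->|gn0] := eqVneq (normc (gb x)) 0; first by rewrite expr0n mulr0.
    by rewrite expr2 mulKf.
  by rewrite normc_cintegral_real ?moment1E// => x; exact: normc_ge0.
have lower : (E + d) * P <= fine (moment 1 gb).
  rewrite -lee_fin (moment_fineK gb1) EFinM PE !moment1E.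
  have Ed0 : 0 <= E + d by rewrite addr_ge0// ltW.
  rewrite -ge0_integralZl_EFin//; last 2 first.
  - by move=> x _; rewrite lee_fin normc_ge0.
  - by apply/measurable_EFinP; exact: measurable_normc.
  apply: ge0_le_integral => //.
  - by move=> x _; rewrite mule_ge0// lee_fin ?normc_ge0.
  - by apply: measurable_funeM; apply/measurable_EFinP; exact: measurable_normc.
  - by apply/measurable_EFinP; exact: measurable_normc.
  move=> x _; rewrite -EFinM lee_fin normch /gb /big -ltNge.
  by case: ifPn => [/ltW|_]; rewrite ?mulr1 ?mulr0// (@normc0 R).
have upper : normc (inner Omega g h) <= E * P.
  apply: (normc_inner_series_le mOmega mu_ u2 ga mh h2) => A AI.
  apply: le_trans (ler_wpM2r P0 (aE A AI)); rewrite mulr_suml.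
  rewrite big_seq [leRHS]big_seq ler_sum// => xi /AI Ixi.
  rewrite -mulrA ler_wpM2l ?normc_ge0// -lee_fin EFinM PE.
  exact: (normc_fourier_le mOmega mu_ (supN_ge0 Omega u) (supN_ae uy) Ixi mh).
have P00 : P = 0.
  by move: upper; rewrite innerE => /(le_trans lower); nra.
have : (\int[mu]_(x in Omega) `|(normc (h x))%:E| = 0)%E.
  rewrite -[RHS]/(0%:E) -P00 PE moment1E; apply: eq_integral => x _.
  by rewrite gee0_abs// lee_fin normc_ge0.
have mnh : measurable_fun Omega (fun x => (normc (h x))%:E).
  by apply/measurable_EFinP; exact: measurable_normc.
move=> /(ae_eq_integral_abs mu mOmega mnh); apply: filterS => x /[apply] /= [].
rewrite normch /big; case: ifPn => [_ /eqP|/negPn//].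
by rewrite eqe oner_eq0.
Qed.

End bounded_series.
Variables (B w0 : R).
Hypothesis B_gt0 : 0 < B.
Hypothesis u_upper : forall (A : {fset ZK}) c, [set` A] `<=` I ->
  (moment 2 (lincomb A c u) <= (B * \sum_(xi <- A) normc (c xi) ^+ 2)%:E)%E.
Hypothesis w0_gt0 : 0 < w0.
Hypothesis w0W : forall xi, I xi -> w0 <= W xi.

(** Sup norms bounded below make the weighted l^p space a subspace of l^2. *)
Lemma sum_sqr_le (a : ZK -> C) (p E : R) : 1 <= p -> p <= 2 ->
  (forall A : {fset ZK}, [set` A] `<=` I ->
    \sum_(xi <- A) normc (a xi) `^ p * W xi `^ (2 - p) <= E) ->
  exists M, forall A : {fset ZK}, [set` A] `<=` I ->
    \sum_(xi <- A) normc (a xi) ^+ 2 <= M.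
Proof.
move=> p1 p2 aE; have p0 : 0 < p by rewrite (lt_le_trans _ p1).
have p20 : 0 <= 2 - p by rewrite subr_ge0.
set c := w0 `^ (2 - p); have c0 : 0 < c by rewrite powR_gt0.
have cW xi : I xi -> normc (a xi) `^ p <= c^-1 * (normc (a xi) `^ p * W xi `^ (2 - p)).
  move=> Ixi; rewrite mulrC ler_pdivlMr// ler_wpM2l ?powR_ge0//.
  by apply: powR_homo_ge0 (ltW w0_gt0) (w0W Ixi).
set k := (c^-1 * E) `^ p^-1.
have ak xi : I xi -> normc (a xi) <= k.
  move=> Ixi; have -> : normc (a xi) = (normc (a xi) `^ p) `^ p^-1.
    by rewrite -powRrM divff ?gt_eqF// powRr1 ?normc_ge0.
  apply: powR_homo_ge0; rewrite ?invr_ge0 ?powR_ge0 ?(ltW p0)//.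
  apply: (le_trans (cW _ Ixi)); rewrite ler_wpM2l ?invr_ge0 ?(ltW c0)//.
  have := aE [fset xi]%fset; rewrite big_seq_fset1; apply.
  by move=> eta /=; rewrite inE => /eqP ->.
exists (k `^ (2 - p) * (c^-1 * E)) => A AI.
apply: (@le_trans _ _ (\sum_(xi <- A) k `^ (2 - p) *
    (c^-1 * (normc (a xi) `^ p * W xi `^ (2 - p))))); last first.
  by rewrite -!mulr_sumr !ler_wpM2l ?powR_ge0 ?invr_ge0 ?(ltW c0) ?aE.
rewrite big_seq [leRHS]big_seq; apply: ler_sum => xi /AI Ixi.
have -> : normc (a xi) ^+ 2 = normc (a xi) `^ (2 - p) * normc (a xi) `^ p.
  rewrite -powRD; last by rewrite subrK (gt_eqF (ltr0Sn R 1)).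
  by rewrite subrK powR_mulrn ?normc_ge0.
apply: ler_pM; rewrite ?powR_ge0//; last exact: cW.
by apply: powR_homo_ge0 => //; [exact: normc_ge0|exact: ak].
Qed.

Lemma inverse_fourier_lpN_le (v : ZK -> Rn -> C) (p : R) (p' : \bar R) :
  1 <= p -> p <= 2 -> (p%:E^-1 + p'^-1 = 1)%E ->
  exists2 D : R, 1 <= D & forall a, (lpN Omega I u v p%:E a < +oo)%E ->
    (exists g, inverse_fourier Omega I u a g) /\
    forall g, inverse_fourier Omega I u a g ->
      (LpN Omega p' g <= D%:E * lpN Omega I u v p%:E a)%E.
Proof.
move=> p1 p2 pp'; have p0 : 0 < p by rewrite (lt_le_trans _ p1).
pose S a := (\esum_(xi in I) (normc (a xi) `^ p * W xi `^ (2 - p))%:E)%E.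
have lpNE a : lpN Omega I u v p%:E a = (S a `^ p^-1)%E by rewrite /lpN p2.
have S0 a : (0 <= S a)%E.
  by apply: esum_ge0 => xi _; rewrite lee_fin mulr_ge0 ?powR_ge0.
have SE a : (lpN Omega I u v p%:E a < +oo)%E -> (fine (S a))%:E = S a.
  rewrite lpNE => aoo; rewrite fineK// ge0_fin_numE//.
  rewrite -(poweRe1 (S0 a)) -(mulVf (lt0r_neq0 p0)) poweRrM.
  exact: poweR_lty.
have aS a : (lpN Omega I u v p%:E a < +oo)%E -> forall A : {fset ZK}, [set` A] `<=` I ->
    \sum_(xi <- A) normc (a xi) `^ p * W xi `^ (2 - p) <= fine (S a).
  by move=> aoo A AI; rewrite -lee_fin SE//; exact: fset_le_esum.
have exg a : (lpN Omega I u v p%:E a < +oo)%E -> exists g, inverse_fourier Omega I u a g.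
  move=> aoo; have [M aM] := sum_sqr_le p1 p2 (aS a aoo).
  exact: (inverse_fourier_exists mOmega finOmega mu_ B_gt0 u_upper aM).
have [[p_eq1 ->]|[{}p1 ->]] := conjugate_cases p1 pp'.
  exists 1 => // a aoo; split; first exact: exg.
  move=> g ga; rewrite mul1e lpNE p_eq1 invr1 poweRe1// -SE//.
  apply: (inverse_fourier_sup_le ga) => A AI.
  apply: le_trans (aS a aoo A AI); rewrite le_eqVlt; apply/orP; left; apply/eqP.
  apply: eq_bigr => xi _; rewrite p_eq1 (_ : 2 - 1 = 1); last by ring.
  by rewrite !powRr1 ?normc_ge0 ?supN_ge0.
have [D D0 HD] := fourier_fset_le mOmega finOmega mu_ u2 uy W_gt0 B_gt0 u_upper p1 p2.
exists (Num.max 1 (D `^ (p / (p - 1))^-1)); first by rewrite le_max lexx.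
move=> a aoo; split; first exact: exg.
have pB : 0 < p - 1 by rewrite subr_gt0.
have q0 : 0 < p / (p - 1) by rewrite divr_gt0.
move=> g ga; have gS := inverse_fourier_moment_le ga p1 p2 (ltW D0) HD (aS a aoo).
rewrite LpN_moment//.
apply: (@le_trans _ _ ((D * fine (S a) `^ (p / (p - 1) - 1))%:E `^ (p / (p - 1))^-1)%E).
  apply: gt0_ler_poweR; rewrite ?invr_ge0 ?(ltW q0)//.
  - by rewrite in_itv/= leey andbT moment_ge0.
  - by rewrite in_itv/= leey andbT lee_fin mulr_ge0 ?powR_ge0 ?(ltW D0).
rewrite lpNE -SE// !poweR_EFin -EFinM lee_fin powRM ?powR_ge0 ?(ltW D0)// -powRrM.
have -> : (p / (p - 1) - 1) / (p / (p - 1)) = p^-1.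
  by field; rewrite !gt_eqF.
by rewrite ler_wpM2r ?powR_ge0// le_max lexx orbT.
Qed.

End hausdorff_young_inverse.
(** * The Hausdorff-Young inequality *)

Lemma lee_pmul_max (R : realType) (x y : R) (z : \bar R) : (0 <= z)%E ->
  (x%:E * z <= (Num.max x y)%:E * z)%E /\ (y%:E * z <= (Num.max x y)%:E * z)%E.
Proof.
by move=> z0; split; apply: lee_wpmul2r => //; rewrite lee_fin le_max lexx ?orbT.
Qed.

Section riesz_families.
Context {R : realType} {n : nat} (Omega : set 'rV[R]_n).
Hypothesis mOmega : measurable Omega.
Hypothesis finOmega : (lebesgue_rV n Omega < +oo)%E.
Context {K : nat} (I : set 'rV[int]_K).
Local Notation Rn := 'rV[R]_n.
Local Notation ZK := 'rV[int]_K.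
Local Notation C := R[i].
Local Notation cmeas := (cmeasurable_fun Omega).
Local Notation moment := (moment Omega).
Implicit Types (u v : ZK -> Rn -> C).

Lemma riesz_basis_upper u : riesz_basis Omega I u ->
  exists2 B : R, 0 < B & forall (A : {fset ZK}) c, [set` A] `<=` I ->
    (moment 2 (lincomb A c u) <= (B * \sum_(xi <- A) normc (c xi) ^+ 2)%:E)%E.
Proof.
move=> [_ _ [B1 [B2 [_ uB]]]]; exists (`|B2| + 1); first by rewrite ltr_wpDl.
move=> A c AI; have /andP[_] := uB A c AI.
rewrite (@poweR_LpN _ _ Omega 2)// => /le_trans; apply; rewrite lee_fin.
apply: ler_wpM2r; first by apply: sumr_ge0 => xi _; exact: sqr_ge0.
by rewrite (le_trans (ler_norm _))// lerDl.
Qed.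

(** On a set of finite measure the sup norm dominates a multiple of the L^2
    norm, which the lower Riesz bound keeps away from 0. *)
Lemma riesz_basis_supN u : riesz_basis Omega I u ->
  (forall xi, I xi -> memLp Omega +oo%E (u xi)) ->
  exists2 w0 : R, 0 < w0 & forall xi, I xi -> w0 <= supN Omega u xi.
Proof.
move=> [_ _ [B1 [B2 [B10 uB]]]] uy.
set m := fine (lebesgue_rV n Omega) + 1.
have m0 : 0 < m by rewrite ltr_wpDl// fine_ge0.
exists (Num.sqrt (B1 / m)) => [|xi Ixi]; first by rewrite sqrtr_gt0 divr_gt0.
have [mu_xi uoo] := uy _ Ixi.
have W0 : 0 <= supN Omega u xi by exact: supN_ge0.
rewrite -(@ler_pXn2r _ 2)// ?nnegrE ?sqrtr_ge0//.
rewrite sqr_sqrtr ?divr_ge0 ?(ltW B10) ?(ltW m0)// ler_pdivrMr// -lee_fin.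
have /(uB _ (fun=> 1))/andP[] : [set` [fset xi]%fset] `<=` I.
  by move=> eta /=; rewrite inE => /eqP ->.
rewrite big_seq_fset1 (@normc1 R) expr1n mulr1 (@poweR_LpN _ _ Omega 2)// => lower _.
apply: (le_trans lower); rewrite moment2E.
apply: (@le_trans _ _ (\int[lebesgue_rV n]_(x in Omega) (supN Omega u xi ^+ 2)%:E)%E).
  have l1E x : lincomb [fset xi]%fset (fun=> 1) u x = u xi x.
    by rewrite /lincomb big_seq_fset1 mul1r.
  under eq_integral do rewrite l1E.
  apply: ae_ge0_le_integral => //.
  - by move=> x _; rewrite lee_fin sqr_ge0.
  - by apply/measurable_EFinP/measurable_funX; exact: measurable_normc mu_xi.
  - by move=> x _; rewrite lee_fin sqr_ge0.
  apply: filterS (LpNy_ae uoo) => x /[apply] uW.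
  by rewrite lee_fin ler_pXn2r// nnegrE normc_ge0.
rewrite integral_cst// (EFinM (_ ^+ 2) m).
apply: lee_wpmul2l; first by rewrite lee_fin sqr_ge0.
by rewrite /m EFinD fineK ?ge0_fin_numE// leeDl.
Qed.

Lemma hausdorff_young u v (p : R) (p' : \bar R) :
  riesz_basis Omega I u -> (forall xi, I xi -> memLp Omega +oo%E (u xi)) ->
  1 <= p -> p <= 2 -> (p%:E^-1 + p'^-1 = 1)%E ->
  exists2 D : R, 1 <= D &
    (forall f, memLp Omega p%:E f ->
      (lpN Omega I v u p' (fourier Omega u f) <= D%:E * LpN Omega p%:E f)%E) /\
    (forall a, (lpN Omega I u v p%:E a < +oo)%E ->
      (exists g, inverse_fourier Omega I u a g) /\
      forall g, inverse_fourier Omega I u a g ->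
        (LpN Omega p' g <= D%:E * lpN Omega I u v p%:E a)%E).
Proof.
move=> rieszu uoo p1 p2 pp'.
have [B B0 uB] := riesz_basis_upper rieszu.
have [w0 w00 w0W] := riesz_basis_supN rieszu uoo.
have mu_ xi : I xi -> cmeas (u xi) by move=> /uoo[].
have u2 xi : I xi -> (moment 2 (u xi) < +oo)%E.
  by case: rieszu => + _ _ => /[apply]/(memLp_moment _ _ (ltr0Sn R 1))[].
have uy xi : I xi -> (LpN Omega +oo (u xi) < +oo)%E by move=> /uoo[].
have W0 xi : I xi -> 0 < supN Omega u xi by move=> /w0W; exact: lt_le_trans.
have [D D1 HD] := fourier_lpN_le mOmega finOmega mu_ u2 uy W0 B0 uB v p1 p2 pp'.
have [D' D'1 HD'] := inverse_fourier_lpN_le mOmega finOmega mu_ u2 uy W0 B0 uB w00 w0W v p1 p2 pp'.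
exists (Num.max D D'); first by rewrite le_max D1.
split=> [f fp|a aoo].
  by apply: le_trans (HD f fp) _; exact: (lee_pmul_max _ _ (Lnorm_ge0 _ _ _)).1.
have [exg gD] := HD' a aoo; split=> // g ga.
apply: le_trans (gD g ga) _; apply: (lee_pmul_max _ _ _).2.
by rewrite /lpN; exact: poweR_ge0.
Qed.

End riesz_families.

Theorem theorem7p6 (R : realType) (n : nat) (n_ge1 : (1 <= n)%N)
  (Omega : set 'rV[R]_n) (Omega_open : open Omega)
  (Omega_bounded : bounded_set Omega)
  (m : nat) (m_gt0 : (0 < m)%N)
  (a_ : {ffun 'I_n -> 'I_m.+1} -> 'rV[R]_n -> R[i])
  (a_smooth : forall alpha, (mdegree alpha <= m)%N ->
     smooth_on Omega (a_ alpha))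
  (a_order : has_order Omega a_)
  (BC : set ('rV[R]_n -> R[i])) (BC_linear : linear_space BC)
  (L : ('rV[R]_n -> R[i]) -> ('rV[R]_n -> R[i]) -> Prop)
  (LE : L = diff_op Omega a_ BC)
  (Lstar : ('rV[R]_n -> R[i]) -> ('rV[R]_n -> R[i]) -> Prop)
  (LstarE : Lstar = adjoint Omega L)
  (L_complete : dom_infty_complete Omega L)
  (Lstar_complete : dom_infty_complete Omega Lstar)
  (K : nat) (I : set 'rV[int]_K) (lambda : 'rV[int]_K -> R[i])
  (L_spectrum : discrete_spectrum Omega I L lambda)
  (u v : 'rV[int]_K -> 'rV[R]_n -> R[i])
  (u_eigen : forall xi, I xi -> L (u xi) (fun x => lambda xi * u xi x))
  (v_eigen : forall xi, I xi ->
     Lstar (v xi) (fun x => conjc (lambda xi) * v xi x))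
  (u_norm : forall xi, I xi -> LpN Omega 2%:E (u xi) = 1%E)
  (uv_biorthogonal : forall xi eta, I xi -> I eta ->
     inner Omega (u xi) (v eta) = (xi == eta)%:R)
  (u_riesz : riesz_basis Omega I u) (v_riesz : riesz_basis Omega I v)
  (u_Loo : forall xi, I xi -> memLp Omega +oo%E (u xi))
  (v_Loo : forall xi, I xi -> memLp Omega +oo%E (v xi))
  (p : R) (p_ge1 : 1 <= p) (p_le2 : p <= 2)
  (p' : \bar R) (pp' : (p%:E^-1 + p'^-1 = 1)%E) :
  exists C : R,
  [/\ 1 <= C,
      forall f, memLp Omega p%:E f ->
        (lpN Omega I u v p' (fourier Omega v f) <= C%:E * LpN Omega p%:E f)%E,
      forall a, memlp Omega I m lambda u v p%:E a ->
        (exists g, inverse_fourier Omega I u a g) /\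
        forall g, inverse_fourier Omega I u a g ->
          (LpN Omega p' g <= C%:E * lpN Omega I u v p%:E a)%E,
      forall f, memLp Omega p%:E f ->
        (lpN Omega I v u p' (fourier Omega u f) <= C%:E * LpN Omega p%:E f)%E &
      forall b, memlp Omega I m lambda v u p%:E b ->
        (exists g, inverse_fourier Omega I v b g) /\
        forall g, inverse_fourier Omega I v b g ->
          (LpN Omega p' g <= C%:E * lpN Omega I v u p%:E b)%E].
Proof.
have mOmega := open_rV_measurable Omega_open.
have finOmega := bounded_lebesgue_rV mOmega Omega_bounded.
have [D D1 [uF uI]] := hausdorff_young mOmega finOmega v u_riesz u_Loo p_ge1 p_le2 pp'.
have [D' D'1 [vF vI]] := hausdorff_young mOmega finOmega u v_riesz v_Loo p_ge1 p_le2 pp'.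
have Lp0 f : (0 <= LpN Omega p%:E f)%E by exact: Lnorm_ge0.
have lp0 w w' a : (0 <= lpN Omega I w w' p%:E a)%E by rewrite /lpN; exact: poweR_ge0.
exists (Num.max D D'); split.
- by rewrite le_max D1.
- by move=> f fp; apply: le_trans (vF f fp) _; exact: (lee_pmul_max _ _ (Lp0 f)).2.
- move=> a [_ aoo]; have [exg gD] := uI a aoo; split=> // g ga.
  by apply: le_trans (gD g ga) _; exact: (lee_pmul_max _ _ (lp0 _ _ _)).1.
- by move=> f fp; apply: le_trans (uF f fp) _; exact: (lee_pmul_max _ _ (Lp0 f)).1.
- move=> b [_ boo]; have [exg gD] := vI b boo; split=> // g gb.
  by apply: le_trans (gD g gb) _; exact: (lee_pmul_max _ _ (lp0 _ _ _)).2.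
Qed.
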